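(* Let $D_k$, $k\in\mathbb N$, be the eigenvalues of the Dirichlet-Laplace operator $\Delta$ on $D(A)=H_0^1(0,L)\cap H^2(0,L)\subset H=L^2(0,L)$, and assume that $\mu\ne-D_k$ for all $k\in\mathbb N$. Then for any $T,\bar q,\beta>0$ there exists $\bar\alpha_d<0$ such that the closed-loop system $$y_t=Ay+\alpha_d\,\beta\,\overline F_q\,y\ \text{ on }[0,\infty)\times(0,L),\qquad y(t,0)=y(t,L)=0,\qquad y(0,x)=y_0(x)$$ is asymptotically stable in $y_d=0$ for any $\alpha_d\le\bar\alpha_d$.
   Context: $L>0$ and $\mu>(\pi/L)^2$ are real constants. $A$ is the operator on $H=L^2(0,L)$ given by $Ay=\mu y+\Delta y$ with domain $D(A)=H_0^1(0,L)\cap H^2(0,L)$; it is self-adjoint and generates the semigroup $e^{tA}$. The operator $\overline F_q$ on $H$ is $$\overline F_q\,y=\int_0^T\bar q^2\,\big(e^{\sigma A}\big)^2y\,d\sigma .$$ The initial state is $y_0\in H$; stability is understood in the norm of $H$. (This closed-loop system is the first-order closed loop for the heat equation $y_t=y_{xx}+\mu y+\sqrt\beta\,u$ with control on the full domain $(0,L)$, $R$ the identity and stage cost $\frac12\int_0^T\int_0^L(\bar q\,y)^2\,dx\,dt$.) *)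

(* Defs.v *)
From HB Require Import structures.
From mathcomp Require Import all_boot all_order all_algebra generic_quotient.
From mathcomp Require Import all_classical all_reals all_analysis measurable_realfun.

Set Implicit Arguments.
Unset Strict Implicit.
Unset Printing Implicit Defensive.

Import Order.TTheory GRing.Theory Num.Theory.
Import numFieldNormedType.Exports.

Local Open Scope classical_set_scope.
Local Open Scope ring_scope.

(* The library has the module [LfunType] of square-integrable functions; L^2 is
   its quotient by almost-everywhere equality, normed by [Lnorm mu 2]. *)
Section L2.
Context d (T : measurableType d) (R : realType).
Variable mu : {measure set T -> \bar R}.

Let V := LfunType mu (lee1n 2).

Definition Lfun_ae_eq (f g : V) : bool := `[< f = g %[ae mu] >].

Let ae_eq_equiv : equiv_class_of Lfun_ae_eq.
Proof.
split.
- by move=> f; apply/asboolP; exact: ae_eq_refl.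
- by move=> f g; apply/asboolP/asboolP; exact: ae_eq_sym.
- by move=> f g h /asboolP gf /asboolP fh; apply/asboolP; exact: ae_eq_trans gf fh.
Qed.

Canonical Lfun_ae_eq_equivRel := EquivRelPack ae_eq_equiv.

Local Open Scope quotient_scope.

Definition L2 : Type := {eq_quot Lfun_ae_eq}.
HB.instance Definition _ := Choice.on L2.
HB.instance Definition _ := EqQuotient.on L2.

Definition L2_fun (f : L2) : T -> R := (repr f : V).
Coercion L2_fun : L2 >-> Funclass.

Lemma L2_piP (f g : V) : \pi_L2 f = \pi_L2 g <-> f = g %[ae mu].
Proof.
split; first by move/eqP; rewrite eqmodE => /asboolP.
by move=> fg; apply/eqP; rewrite eqmodE; exact/asboolP.
Qed.

Lemma L2_repr_pi (f : V) : repr (\pi_L2 f) = f %[ae mu].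
Proof. by apply/L2_piP; rewrite reprK. Qed.

Definition L2_zero : L2 := \pi_L2 0.
Definition L2_opp (f : L2) : L2 := \pi_L2 (- repr f).
Definition L2_add (f g : L2) : L2 := \pi_L2 (repr f + repr g).
Definition L2_scale (a : R) (f : L2) : L2 := \pi_L2 (a *: repr f).

Let pi_opp (f : V) : L2_opp (\pi f) = \pi_L2 (- f).
Proof.
apply/L2_piP; have := L2_repr_pi f.
by apply: filterS => x /= e Dx; rewrite !fctE e.
Qed.

Let pi_add (f g : V) : L2_add (\pi f) (\pi g) = \pi_L2 (f + g).
Proof.
apply/L2_piP; have := L2_repr_pi f; have := L2_repr_pi g.
by apply: filterS2 => x /= eg ef Dx; rewrite !fctE eg// ef.
Qed.

Let pi_scale a (f : V) : L2_scale a (\pi f) = \pi_L2 (a *: f).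
Proof.
apply/L2_piP; have := L2_repr_pi f.
by apply: filterS => x /= e Dx; rewrite !fctE e.
Qed.

Let L2_ind (P : L2 -> Prop) : (forall f : V, P (\pi f)) -> forall f, P f.
Proof. by move=> h f; rewrite -[f]reprK. Qed.

Let addA : associative L2_add.
Proof.
elim/L2_ind=> f; elim/L2_ind=> g; elim/L2_ind=> h.
by rewrite !pi_add addrA.
Qed.

Let addC : commutative L2_add.
Proof. by elim/L2_ind=> f; elim/L2_ind=> g; rewrite !pi_add addrC. Qed.

Let add0 : left_id L2_zero L2_add.
Proof. by elim/L2_ind=> f; rewrite pi_add add0r. Qed.

Let addN : left_inverse L2_zero L2_opp L2_add.
Proof. by elim/L2_ind=> f; rewrite pi_opp pi_add addNr. Qed.

HB.instance Definition _ := GRing.isZmodule.Build L2 addA addC add0 addN.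

Let scaleA a b f : L2_scale a (L2_scale b f) = L2_scale (a * b) f.
Proof. by elim/L2_ind: f => f; rewrite !pi_scale scalerA. Qed.

Let scale1 : left_id 1 L2_scale.
Proof. by elim/L2_ind=> f; rewrite pi_scale scale1r. Qed.

Let scaleDr : right_distributive L2_scale +%R.
Proof.
by move=> a; elim/L2_ind=> f; elim/L2_ind=> g;
   rewrite [LHS](congr1 _ (pi_add _ _)) !pi_scale scalerDr -[LHS]pi_add.
Qed.

Let scaleDl f : {morph L2_scale^~ f : a b / a + b}.
Proof.
by move=> a b; elim/L2_ind: f => f; rewrite !pi_scale scalerDl -[LHS]pi_add.
Qed.

HB.instance Definition _ :=
  GRing.Zmodule_isLmodule.Build R L2 scaleA scale1 scaleDr scaleDl.

Lemma L2_piD (f g : V) : \pi_L2 (f + g) = \pi_L2 f + \pi_L2 g.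
Proof. by rewrite -pi_add. Qed.

Lemma L2_piZ a (f : V) : \pi_L2 (a *: f) = a *: \pi_L2 f.
Proof. by rewrite -pi_scale. Qed.

Lemma Lnorm_ae_eq (f g : V) : f = g %[ae mu] ->
  ('N[mu]_2%:E[EFin \o f] = 'N[mu]_2%:E[EFin \o g])%E.
Proof.
move=> fg; rewrite unlock; congr (_ `^ _)%E.
pose n2 (h : V) (x : T) : \bar R := (`|(EFin \o h) x| `^ 2)%E.
have mn2 h : measurable_fun [set: T] (n2 h).
  rewrite (_ : n2 h = EFin \o (fun x => `|h x| `^ 2))//.
  apply/measurable_EFinP/(measurableT_comp (measurable_powR _)).
  exact/measurableT_comp.
apply: (@ae_eq_integral _ _ _ _ _ (n2 g) (n2 f)) => //.
by apply: filterS fg => x e Dx; rewrite /n2 /= e.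
Qed.

Definition L2_norm (f : L2) : R := fine ('N[mu]_2%:E[EFin \o (f : T -> R)])%E.

Let norm_pi (f : V) : L2_norm (\pi f) = fine ('N[mu]_2%:E[EFin \o f])%E.
Proof. by congr fine; apply: Lnorm_ae_eq; exact: L2_repr_pi. Qed.

Let ler_normD f g : L2_norm (f + g) <= L2_norm f + L2_norm g.
Proof.
elim/L2_ind: f => f; elim/L2_ind: g => g.
by rewrite -L2_piD !norm_pi; exact: ler_LnormD.
Qed.

Let normrZ a f : L2_norm (a *: f) = `|a| * L2_norm f.
Proof.
elim/L2_ind: f => f; rewrite -L2_piZ !norm_pi.
by apply: EFin_inj; rewrite EFinM !finite_norm_fine -LnormZ.
Qed.

Let normr0_eq0 f : L2_norm f = 0 -> f = 0.
Proof.
elim/L2_ind: f => f; rewrite norm_pi => /fine_Lnormr_eq0 f0.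
by apply/L2_piP; apply: filterS f0 => x e Dx; rewrite e.
Qed.

HB.instance Definition _ :=
  Lmodule_isNormed.Build R L2 ler_normD normrZ normr0_eq0.

Lemma L2_normE (f : L2) : `|f| = fine ('N[mu]_2%:E[EFin \o (f : T -> R)])%E.
Proof. by []. Qed.

Lemma L2_norm_pi (f : V) : `|\pi_L2 f| = fine ('N[mu]_2%:E[EFin \o f])%E.
Proof. exact: norm_pi. Qed.

End L2.

Section NormedModule.
Context (R : realType) (V : normedModType R).

(* Riemann integral: [z] is the limit in norm of the Riemann sums of [f] over
   the tagged partitions [p 0 <= xi 0 <= p 1 <= ... <= p n] of [a, b]. *)
Definition is_Rint (f : R -> V) (a b : R) (z : V) : Prop :=
  forall e : R, 0 < e -> exists2 r : R, 0 < r &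
    forall (n : nat) (p xi : nat -> R), p 0%N = a -> p n = b ->
      (forall i, (i < n)%N ->
        [/\ p i <= xi i, xi i <= p i.+1 & p i.+1 - p i < r]) ->
      `|\sum_(i < n) (p i.+1 - p i) *: f (xi i) - z| < e.

Definition Rint (f : R -> V) (a b : R) : V := xget 0 [set z | is_Rint f a b z].

(* Only the values of [S] at nonnegative times matter. *)
Record C0_semigroup (S : R -> V -> V) : Prop := {
  C0_linear : forall t : R, 0 <= t -> linear (S t) ;
  C0_bounded : forall t : R, 0 <= t -> continuous (S t) ;
  C0_id : forall x, S 0 x = x ;
  C0_comp : forall (s t : R) x, 0 <= s -> 0 <= t -> S (s + t) x = S s (S t x) ;
  C0_cvg : forall x, S t x @[t --> 0^'+] --> x }.

(* An unbounded operator [A] is given by its graph, the set of the pairs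
   [(x, A x)] for [x] in the domain of [A]. *)
Definition generates (A : set (V * V)) (S : R -> V -> V) : Prop :=
  C0_semigroup S /\
  forall x z, A (x, z) <-> h^-1 *: (S h x - x) @[h --> 0^'+] --> z.

Definition eigenvalue_of (A : set (V * V)) (d : R) : Prop :=
  exists2 x, x != 0 & A (x, d *: x).

(* Mild solution on [0, +oo[ of [y' = A y + B y], [y 0 = y0], for the generator
   [A] of [S]:  y(t) = S(t) y0 + \int_0^t S(t - s) B y(s) ds. *)
Definition mild_solution (S : R -> V -> V) (B : V -> V) (y0 : V)
    (y : R -> V) : Prop :=
  {within `[0, +oo[, continuous y} /\
  forall t : R, 0 <= t -> is_Rint (fun s => S (t - s) (B (y s))) 0 t (y t - S t y0).

(* [Sol y0 y] reads "[y] is a solution with initial state [y0]".  Solutions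
   exist for every initial state, [yd] is Lyapunov stable and attracts all
   solutions.  For linear systems, stability entails uniqueness of solutions. *)
Definition asymptotically_stable (Sol : V -> (R -> V) -> Prop) (yd : V) : Prop :=
  [/\ forall y0, exists y, Sol y0 y,
      forall e : R, 0 < e -> exists2 r : R, 0 < r &
        forall y0 y, Sol y0 y -> `|y0 - yd| < r ->
          forall t : R, 0 <= t -> `|y t - yd| < e
    & forall y0 y, Sol y0 y -> y t @[t --> +oo] --> yd].

End NormedModule.

Definition leb (R : realType) (L : R) :
    {measure set (measurableTypeR R) -> \bar R} :=
  mrestr (@lebesgue_measure R) (measurable_itv `]0, L[).

Notation L2I L := (L2 (leb L)).

Section Dirichlet.
Context (R : realType).

(* As in Brezis' one-dimensional theory of Sobolev spaces, the test functions
   are C^1 with compact support in ]0, L[; they define the same weak derivatives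
   and the same space H^1_0 as the smooth ones. *)
Definition test_function (L : R) (phi : R -> R) : Prop :=
  [/\ forall x : R, derivable phi x 1, continuous (derive1 phi) &
      exists a b : R, [/\ 0 < a, b < L & forall x : R, x \notin `[a, b] -> phi x = 0]].

Definition weak_derivative (L : R) (f g : L2I L) : Prop :=
  forall phi, test_function L phi ->
    \int[leb L]_x (f x * derive1 phi x) = - \int[leb L]_x (g x * phi x).

(* Closure of the test functions in the norm of H^1. *)
Definition in_H1_0 (L : R) (f : L2I L) : Prop :=
  exists2 f1 : L2I L, weak_derivative f f1 &
    forall e : R, 0 < e -> exists2 phi, test_function L phi &
      ('N[leb L]_2%:E[EFin \o (fun x => (f x - phi x)%R)] < e%:E)%E /\
      ('N[leb L]_2%:E[EFin \o (fun x => (f1 x - derive1 phi x)%R)] < e%:E)%E.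

Definition is_second_derivative (L : R) (f f2 : L2I L) : Prop :=
  exists2 f1 : L2I L, weak_derivative f f1 & weak_derivative f1 f2.

Definition in_H2 (L : R) (f : L2I L) : Prop := exists f2, is_second_derivative f f2.

Definition laplacian (L : R) : set (L2I L * L2I L) :=
  [set fg | [/\ in_H1_0 fg.1, in_H2 fg.1 & is_second_derivative fg.1 fg.2]].

Definition opA (L mu : R) : set (L2I L * L2I L) :=
  [set (fg.1, mu *: fg.1 + fg.2) | fg in @laplacian L].

Definition Fbar (L : R) (S : R -> L2I L -> L2I L) (T q : R) (y : L2I L) : L2I L :=
  Rint (fun s => q ^+ 2 *: S s (S s y)) 0 T.

End Dirichlet.

Arguments laplacian {R} L.
Arguments opA {R} L mu.

(* Main.v *)
From HB Require Import structures.
Require Import Defs.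
From mathcomp Require Import all_boot all_order all_algebra.
From mathcomp Require Import all_classical all_reals all_analysis measurable_realfun.
From mathcomp Require Import lra ring.

Set Implicit Arguments.
Unset Strict Implicit.
Unset Printing Implicit Defensive.

Import Order.TTheory GRing.Theory Num.Theory.
Import numFieldNormedType.Exports.

Local Open Scope classical_set_scope.
Local Open Scope ring_scope.

(** The spectral decomposition of the Dirichlet Laplacian is not needed: the
    argument works for every symmetric generator [A] of a C0 semigroup [S] on a
    Hilbert space.  As [S] is then symmetric, [|S s z|^2 = <S (2 s) z, z>] is
    convex in [s] and lies above its tangent [|z|^2 + 2 s <A z, z>] at [0].
    This bounds [<A z, z>] from above, and if [<A z, z> >= - |z|^2 / (4 T)] it
    yields [<F z, z> >= q^2 T |z|^2 / 2].  Hence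
    [<A z, z> + alpha beta <F z, z> <= - |z|^2 / (4 T)] for [alpha] sufficiently
    negative.  Since the bounded operator [B = alpha beta F] commutes with [S],
    the mild solution is [exp (t B) S t y0]; it decays exponentially for [y0] in
    the domain of [A], which is dense, and it is unique by a Gronwall argument.
    [L2] is complete (Riesz-Fischer), and the Laplacian is symmetric because the
    two weak derivatives provided by [H2] and [H1_0] have the same inner product
    with derivatives of test functions. *)

(** * Riemann sums *)

Section ContinuousFunctions.
Context (R : realType) (V : normedModType R).

(** The generator controls right difference quotients only, and [S] is meaningful at nonnegative
    times only. Differentiation in time is therefore replaced by first-order estimates with error
    [e * h] for small [h > 0], which a one-sided Dini argument ([right_dini_le]) integrates;
    functions of time are extended to the line by freezing them at [0], through [Num.max 0 t].
    Integrals being norm limits of Riemann sums, bounds on them come from telescoping bounds on the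
    sums.

    When [<A z, z> < - |z|^2 / (4 T)], the signs [<F z, z> >= 0] and [alpha <= 0] suffice. Otherwise
    the tangent taken at time [1], with [|S 1 z| <= M |z|], gives [2 <A z, z> <= M^2 |z|^2]; this is
    the origin of the threshold [alpha beta <= - 2 (M^2 + 1 / (4 T)) / (q^2 T)]. The resulting decay
    rate [1 / (4 T)] does not depend on [alpha]. *)

Lemma uniformly_continuous_itv (f : R -> V) (a b : R) : continuous f ->
  forall e : R, 0 < e -> exists2 r : R, 0 < r &
    forall x y, x \in `[a, b] -> `|x - y| < r -> `|f x - f y| <= e.
Proof.
move=> cf e e0.
(* Compactness in covering form: a property that holds for all points near each [x] and all small
   [r] holds for one [r] and all [x]. Here [y] may leave [[a, b]], which spares endpoint cases
   later. *)
have /compact_near_coveringP cab := @segment_compact R a b.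
have := cab R (0^'+) (fun r x => forall y, `|x - y| < r -> `|f x - f y| <= e) _.
case=> [x _|r /= r0 Hr].
  have /cvgrPdist_lt/(_ (e / 2)) := cf x.
  rewrite divr_gt0// => /(_ isT) [d /= d0 Hd].
  exists (ball x (d / 2), [set r | r < d / 2]) => /=.
    split; first by apply: nbhsx_ballx; rewrite divr_gt0.
    by apply: nbhs_right_lt; rewrite divr_gt0.
  move=> [x' r] /= [xx' rd] y x'y.
  have h1 : `|f x - f x'| < e / 2.
    apply: Hd; rewrite /ball_/=; move: xx'; rewrite -ball_normE/= => xx'.
    by rewrite (lt_trans xx')// ltr_pdivrMr// ltr_pMr// ltr1n.
  have h2 : `|f x - f y| < e / 2.
    apply: Hd; rewrite /ball_/=; move: xx'; rewrite -ball_normE/= => xx'.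
    move: rd => /= rd.
    by rewrite (le_lt_trans (ler_distD x' x y))// (splitr d) ltrD// (lt_trans x'y).
  rewrite (le_trans (ler_distD (f x) (f x') (f y)))// (splitr e) lerD ?(ltW h2)//.
  by rewrite distrC ltW.
exists (r / 2); first by rewrite divr_gt0.
move=> x y xab; apply: (Hr (r / 2)) => //=; rewrite ?divr_gt0//.
  by rewrite sub0r normrN gtr0_norm; lra.
Qed.

Lemma continuous_bounded_itv (f : R -> V) (a b : R) :
  {within `[a, b], continuous f} ->
  exists2 M : R, 0 < M & forall x, x \in `[a, b] -> `|f x| <= M.
Proof.
move=> cf; have := continuous_compact cf (@segment_compact R a b).
move=> /compact_bounded [M [Mreal HM]].
exists (`|M| + 1); first by rewrite ltr_wpDl.
move=> x xab; apply: (HM (`|M| + 1)); last by exists x.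
by rewrite (le_lt_trans (ler_norm _))// ltrDl.
Qed.

End ContinuousFunctions.

Lemma seq_complete (R : realType) (V : completeNormedModType R) (u : nat -> V) :
  (forall e : R, 0 < e ->
    exists N : nat, forall m, (N <= m)%N -> `|u m - u N| < e) ->
  exists l : V, u n @[n --> \oo] --> l.
Proof.
move=> uC; apply/cvg_ex.
apply: cauchy_cvg; apply: cauchy_exP => e /uC [N HN]; exists (u N).
by exists N => // m /= Nm; rewrite -ball_normE/ball_/= distrC; exact: HN.
Qed.

Lemma cvg_norm_le (R : realType) (V : normedModType R) (u : nat -> V) l (c : R) :
  u n @[n --> \oo] --> l -> (\forall n \near \oo, `|u n| <= c) -> `|l| <= c.
Proof.
move=> ul uc; have /cvg_lim <- // : `|u n| @[n --> \oo] --> `|l| by exact: cvg_norm.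
by apply: limr_le => //; apply/cvg_ex; exists `|l|; exact: cvg_norm.
Qed.

Section RiemannSums.
Context (R : realType) (V : normedModType R).
Implicit Types (f g : R -> V) (a b : R).

(** The grid has [n.+1] cells, so that no [n] leads to a division by zero. *)
Definition grid a b (n i : nat) : R := a + (b - a) * (i%:R / n.+1%:R).

Lemma grid0 a b n : grid a b n 0 = a.
Proof. by rewrite /grid mul0r mulr0 addr0. Qed.

Lemma gridn a b n : grid a b n n.+1 = b.
Proof. by rewrite /grid divff ?pnatr_eq0// mulr1 addrC subrK. Qed.

Lemma gridS a b n i : grid a b n i.+1 - grid a b n i = (b - a) / n.+1%:R.
Proof.
by rewrite /grid opprD addrACA subrr add0r -mulrBr -mulrBl -natr1 addrAC subrr add0r mul1r.
Qed.

Lemma gridS_ge0 a b n i : a <= b -> grid a b n i <= grid a b n i.+1.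
Proof. by move=> ab; rewrite -subr_ge0 gridS divr_ge0// subr_ge0. Qed.

Lemma partition_le n (p : nat -> R) i j :
  (forall i, (i < n)%N -> p i <= p i.+1) -> (i <= j <= n)%N -> p i <= p j.
Proof.
move=> pS /andP[ij jn]; elim: j ij jn => [|j IH]; first by case: i.
rewrite leq_eqVlt => /predU1P[-> //|ij] jn.
by rewrite (le_trans (IH _ (ltnW jn)) (pS _ _)).
Qed.

(** The common source of all bounds on Riemann sums: a potential [g] whose increments dominate the
    summands. A linear [g] gives length times supremum, an exponential one the Gronwall step, a
    geometric one the tail of a fast Cauchy sequence. *)
Lemma sum_telescope_le n (u : nat -> V) (g : nat -> R) :
  (forall i, (i < n)%N -> `|u i| <= g i.+1 - g i) ->
  `|\sum_(i < n) u i| <= g n - g 0%N.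
Proof.
elim: n => [|n IH] H; first by rewrite big_ord0 normr0 subrr.
rewrite big_ord_recr/= (le_trans (ler_normD _ _))//.
by have := IH (fun i hi => H i (ltnW hi)); have := H n (leqnn _); lra.
Qed.

Lemma telescope_vec n (G : nat -> V) : G n - G 0%N = \sum_(i < n) (G i.+1 - G i).
Proof. by rewrite -(big_mkord xpredT (fun i => G i.+1 - G i)) telescope_sumr. Qed.

(** One explicit sequence converging to the integral whenever it exists, through which uniqueness,
    linearity and order pass to the limit. *)
Definition lsum f a b n : V :=
  \sum_(i < n.+1) (grid a b n i.+1 - grid a b n i) *: f (grid a b n i).

Lemma mesh_cvg0 a b (e : R) : 0 < e -> \forall n \near \oo, (b - a) / n.+1%:R < e.
Proof.
move=> e0; have h : (b - a) / n.+1%:R @[n --> \oo] --> (b - a) * 0.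
  by apply: cvgMr; exact: cvg_harmonic.
move: h; rewrite mulr0 => /cvgrPdist_lt/(_ e e0); apply: filterS => n.
by rewrite sub0r normrN; apply: le_lt_trans; exact: ler_norm.
Qed.

Lemma lsum_cvg f a b z : a <= b -> is_Rint f a b z ->
  lsum f a b n @[n --> \oo] --> z.
Proof.
move=> ab fz; apply/cvgrPdist_lt => e /fz[r r0 Hr].
have := mesh_cvg0 a b r0; apply: filterS => n nr.
rewrite distrC; apply: Hr; rewrite ?grid0 ?gridn// => i _.
by split; rewrite ?gridS// gridS_ge0.
Qed.

Lemma is_Rint_unique f a b z w : a <= b -> is_Rint f a b z -> is_Rint f a b w -> z = w.
Proof.
move=> ab /(lsum_cvg ab) fz /(lsum_cvg ab) fw.
exact: (cvg_unique _ fz fw).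
Qed.

Lemma RintE f a b z : a <= b -> is_Rint f a b z -> Defs.Rint f a b = z.
Proof.
move=> ab fz; rewrite /Defs.Rint; case: xgetP => [w -> fw|/(_ z)//].
exact: is_Rint_unique ab fw fz.
Qed.

Lemma eq_is_Rint f g a b z : (forall x, a <= x <= b -> f x = g x) ->
  is_Rint f a b z -> is_Rint g a b z.
Proof.
move=> fg fz e /fz[r r0 Hr]; exists r => // n p xi p0 pn pS.
suff -> : \sum_(i < n) (p i.+1 - p i) *: g (xi i) =
  \sum_(i < n) (p i.+1 - p i) *: f (xi i) by exact: Hr.
apply: eq_bigr => i _; congr (_ *: _).
have [h1 h2 _] := pS i (ltn_ord i).
have pS' k : (k < n)%N -> p k <= p k.+1 by move=> /pS[+ + _]; exact: le_trans.
rewrite fg//; apply/andP; rewrite -p0 -pn; split.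
  by rewrite (le_trans _ h1)//; apply: (partition_le pS'); rewrite leq0n ltnW.
by rewrite (le_trans h2)//; apply: (partition_le pS'); rewrite leqnn andbT ltn_ord.
Qed.

Lemma is_RintB f g a b z w : is_Rint f a b z -> is_Rint g a b w ->
  is_Rint (fun s => f s - g s) a b (z - w).
Proof.
move=> fz gw e e0; have e2 : 0 < e / 2 by rewrite divr_gt0.
have [r r0 Hr] := fz _ e2; have [r' r'0 Hr'] := gw _ e2.
exists (Num.min r r') => [|n p xi p0 pn pS]; first by rewrite lt_min r0.
have -> : \sum_(i < n) (p i.+1 - p i) *: (f (xi i) - g (xi i)) - (z - w) =
    (\sum_(i < n) (p i.+1 - p i) *: f (xi i) - z) -
    (\sum_(i < n) (p i.+1 - p i) *: g (xi i) - w).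
  rewrite opprB opprD opprK addrACA [w - z]addrC -sumrB; congr (_ + _).
  by apply: eq_bigr => i _; rewrite scalerBr.
rewrite (le_lt_trans (ler_normB _ _))// (splitr e) ltrD//.
  by apply: Hr => // i /pS[h1 h2]; rewrite lt_min => /andP[].
by apply: Hr' => // i /pS[h1 h2]; rewrite lt_min => /andP[].
Qed.

(** Left Riemann sums suffice, hence [f] is compared with [g] at left endpoints only. For a convex
    [g] this is the favourable side, as its slope at [s] is at most its mean slope on [[s, t]]. *)
Lemma is_Rint_norm_le f a b z (g : R -> R) : a <= b -> is_Rint f a b z ->
  (forall s t, a <= s -> s <= t -> t <= b -> `|(t - s) *: f s| <= g t - g s) ->
  `|z| <= g b - g a.
Proof.
move=> ab fz H; apply: (cvg_norm_le (lsum_cvg ab fz)); apply: nearW => n.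
have gS k : (k < n.+1)%N -> grid a b n k <= grid a b n k.+1 by move=> _; exact: gridS_ge0.
have -> : g b - g a = (g \o grid a b n) n.+1 - (g \o grid a b n) 0%N.
  by rewrite /= gridn grid0.
apply: (@sum_telescope_le _ (fun i => (grid a b n i.+1 - grid a b n i) *: f (grid a b n i)))
  => i ni /=; apply: H; last 2 [exact: gridS_ge0].
- by rewrite -[leLHS](grid0 a b n); apply: (partition_le gS); rewrite leq0n ltnW.
- by rewrite -[leRHS](gridn a b n); apply: (partition_le gS); rewrite leqnn andbT.
Qed.

Lemma is_Rint_primitive f (G : R -> V) a b :
  (forall e : R, 0 < e -> exists2 r : R, 0 < r & forall s x t,
     a <= s -> s <= x -> x <= t -> t <= b -> t - s < r ->
     `|(t - s) *: f x - (G t - G s)| <= e * (t - s)) ->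
  is_Rint f a b (G b - G a).
Proof.
move=> H e e0; have [ab|ba] := leP a b; last first.
  (* For [b < a] the claim is vacuous, because the tags force a partition to be nondecreasing. *)
  exists 1 => // n p xi p0 pn pS; exfalso.
  suff : p 0%N <= p n by rewrite p0 pn leNgt ba.
  by apply: (@partition_le n) => [i /pS[+ + _]|]; [exact: le_trans|rewrite leqnn].
have ba0 : 0 < b - a + 1 by rewrite ltr_wpDl ?subr_ge0.
have [r r0 Hr] := H (e / (b - a + 1)) (divr_gt0 e0 ba0).
exists r => // n p xi p0 pn pS.
have pS' k : (k < n)%N -> p k <= p k.+1 by move=> /pS[+ + _]; exact: le_trans.
have -> : G b - G a = (G \o p) n - (G \o p) 0%N by rewrite /= p0 pn.
rewrite telescope_vec -sumrB.
apply: (@le_lt_trans _ _ (e / (b - a + 1) * p n - e / (b - a + 1) * p 0%N)).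
  apply: (@sum_telescope_le _
    (fun i => (p i.+1 - p i) *: f (xi i) - (G (p i.+1) - G (p i)))
    (fun i => e / (b - a + 1) * p i)) => i ni /=.
  have [h1 h2 h3] := pS i ni; rewrite -mulrBr; apply: Hr => //.
    by rewrite -p0; apply: (partition_le pS'); rewrite leq0n ltnW.
  by rewrite -pn; apply: (partition_le pS'); rewrite leqnn andbT.
rewrite p0 pn -mulrBr mulrAC ltr_pdivrMr// ltr_pM2l//; lra.
Qed.

End RiemannSums.

Lemma is_Rint_map (R : realType) (V W : normedModType R) (K : {linear V -> W})
    (f : R -> V) (a b : R) z :
  continuous K -> is_Rint f a b z -> is_Rint (K \o f) a b (K z).
Proof.
move=> cK fz e e0; have /cvgrPdist_lt/(_ e e0)/nbhs_normP[d /= d0 Hd] := cK 0.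
have [r r0 Hr] := fz d d0; exists r => // n p xi p0 pn pS.
have := Hd (z - \sum_(i < n) (p i.+1 - p i) *: f (xi i)).
rewrite /ball_/= sub0r normrN distrC => /(_ (Hr _ _ _ p0 pn pS)).
rewrite linear0 sub0r normrN linearB/= linear_sum distrC; congr (`| _ - _ | < _).
by apply: eq_bigr => i _; rewrite linearZ.
Qed.

(** * Right derivatives and primitives *)

(** Consider the points of [[a, b]] where [v] is below the line of slope [e] through [(a, v a)]. By
    continuity their supremum is such a point; the right estimate moves past it unless it equals
    [b]. Then [e] tends to [0]. *)
Lemma right_dini_le (R : realType) (v : R -> R) (a b : R) : a <= b ->
  (forall c, a <= c <= b -> forall e : R, 0 < e -> exists2 d : R, 0 < d &
     forall x, a <= x <= b -> `|x - c| < d -> `|v x - v c| <= e) ->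
  (forall s, a <= s < b -> forall e : R, 0 < e ->
     \forall h \near 0^'+, v (s + h) - v s <= e * h) ->
  v b <= v a.
Proof.
move=> ab cv dv; apply/ler_addgt0Pr => e' e'0.
pose e := e' / (b - a + 1).
have ba0 : 0 < b - a + 1 by rewrite ltr_wpDl ?subr_ge0.
have e0 : 0 < e by rewrite divr_gt0.
pose A := [set x | a <= x <= b /\ v x <= v a + e * (x - a)].
have Aa : A a by rewrite /A/= lexx ab subrr mulr0 addr0.
have As : has_sup A.
  by split; [exists a|exists b => x [/andP[_ ?]]].
pose c := sup A.
have ac : a <= c by apply: ub_le_sup => //; case: As.
have cb : c <= b by apply: ge_sup => //; [exists a|move=> x [/andP[_ ?]]].
have Ac : v c <= v a + e * (c - a).
  apply/ler_addgt0Pr => n n0.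
  have acb : a <= c <= b by rewrite ac.
  have [d d0 Hd] := cv c acb n n0.
  have [x [axb vx] xc] := sup_adherent d0 As.
  have xlec : x <= c by apply: ub_le_sup => //; case: As.
  have := Hd x axb; rewrite ltr_distl ler_distl -/c in xc *.
  have -> : (c - d < x) && (x < c + d) by apply/andP; split => //; lra.
  move=> /(_ isT) /andP[h _].
  have : e * (x - a) <= e * (c - a) by rewrite ler_pM2l//; lra.
  lra.
suff cbE : c = b.
  rewrite -cbE (le_trans Ac)// lerD2l /e mulrAC ler_pdivrMr// ler_pM2l//; lra.
apply/eqP; rewrite eq_le cb/= leNgt; apply/negP => cltb.
have acb : a <= c < b by rewrite ac.
have near1 := dv c acb e e0.
have near2 : \forall h \near 0^'+, h < b - c by apply: nbhs_right_lt; rewrite subr_gt0.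
have near3 : \forall h \near (0 : R)^'+, 0 < h by exact: nbhs_right_gt.
have [h [[h1 h2] h3]] := filter_ex (filterI (filterI near1 near2) near3).
suff : c + h <= c by lra.
apply: ub_le_sup; first by case: As.
split; first by apply/andP; split; lra.
have -> : e * (c + h - a) = e * (c - a) + e * h by rewrite -mulrDr; congr (_ * _); lra.
lra.
Qed.

(** The scalar lemma applies to [|f x - f a|], whose increments are dominated by those of [f]. *)
Lemma right_derive0_eq (R : realType) (V : normedModType R) (f : R -> V) (a b : R) :
  a <= b ->
  (forall c, a <= c <= b -> forall e : R, 0 < e -> exists2 d : R, 0 < d &
     forall x, a <= x <= b -> `|x - c| < d -> `|f x - f c| <= e) ->
  (forall s, a <= s < b -> forall e : R, 0 < e ->
     \forall h \near 0^'+, `|f (s + h) - f s| <= e * h) ->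
  f b = f a.
Proof.
move=> ab cf df; apply/eqP; rewrite -subr_eq0 -normr_le0.
rewrite (_ : 0 = `|f a - f a|); last by rewrite subrr normr0.
apply: (@right_dini_le _ (fun x => `|f x - f a|)) => //.
  move=> c acb e e0; have [d d0 Hd] := cf c acb e e0.
  exists d => // x axb xc; rewrite (le_trans (ler_dist_dist _ _))//.
  by rewrite opprB addrA subrK; exact: Hd.
move=> s asb e e0; have := df s asb e e0; apply: filterS => h; apply: le_trans.
rewrite (le_trans (ler_norm _))// (le_trans (ler_dist_dist _ _))//.
by rewrite opprB addrA subrK.
Qed.

(** * Primitives of continuous vector-valued functions *)

Section Primitive.
Context (R : realType) (V : completeNormedModType R) (f : R -> V) (a b : R).
Hypotheses (ab : a <= b) (cf : continuous f).

(** The integral over [[a, t]] of the step function equal to [f (grid a b n i)] on the [i]-th cell;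
    [Num.min] clips the cells at [t], so that one grid serves all [t]. *)
Let step_primitive n t : V := \sum_(i < n.+1)
  (Num.min t (grid a b n i.+1) - Num.min t (grid a b n i)) *: f (grid a b n i).

Let small_mesh n (w : R) := forall x y, a <= x <= b ->
  `|x - y| <= (b - a) / n.+1%:R -> `|f x - f y| <= w.

Let grid_in n i : (i <= n.+1)%N -> a <= grid a b n i <= b.
Proof.
move=> ni.
have pS k : (k < n.+1)%N -> grid a b n k <= grid a b n k.+1 by move=> _; exact: gridS_ge0.
have := @partition_le _ _ _ 0%N i pS; have := @partition_le _ _ _ i n.+1 pS.
by rewrite grid0 gridn leqnn ni /= => -> // ->.
Qed.

Let small_mesh_near (w : R) : 0 < w -> \forall n \near \oo, small_mesh n w.
Proof.
move=> w0; have [r r0 Hr] := uniformly_continuous_itv a b cf w0.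
have := mesh_cvg0 a b r0; apply: filterS => n nr x y axb xy.
by apply: Hr; rewrite ?in_itv/= ?axb// (le_lt_trans xy).
Qed.

Let step_estimate n s t v (e w : R) : a <= s -> s <= t -> t <= b ->
  (forall u, s <= u <= t -> `|f u - v| <= e) -> small_mesh n w ->
  `|(t - s) *: v - (step_primitive n t - step_primitive n s)| <= (e + w) * (t - s).
Proof.
move=> as_ st tb Hv Hw; pose p := grid a b n.
(* [g i] is the length of the part of [[s, t]] to the left of [p i], so its increments are the
   overlaps of [[s, t]] with the cells. *)
pose g i := Num.min t (p i) - Num.min s (p i).
have g0 : g 0%N = 0.
  by rewrite /g /p grid0 !min_r ?subrr// (le_trans as_).
have gn : g n.+1 = t - s.
  by rewrite /g /p gridn !min_l// (le_trans st).
have -> : (t - s) *: v = (g n.+1 *: v) - (g 0%N *: v) by rewrite g0 gn scale0r subr0.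
rewrite (telescope_vec n.+1 (fun i => g i *: v)) -!sumrB.
have -> : (e + w) * (t - s) = (e + w) * g n.+1 - (e + w) * g 0%N.
  by rewrite g0 gn mulr0 subr0.
apply: (@sum_telescope_le _ _ _ (fun i => g i.+1 *: v - g i *: v -
  ((Num.min t (p i.+1) - Num.min t (p i)) *: f (p i) -
   (Num.min s (p i.+1) - Num.min s (p i)) *: f (p i))) (fun i => (e + w) * g i)) => i ni.
have pi : p i <= p i.+1 by exact: gridS_ge0.
have pii : p i.+1 - p i = (b - a) / n.+1%:R by exact: gridS.
rewrite -!scalerBl.
have -> : Num.min t (p i.+1) - Num.min t (p i) - (Num.min s (p i.+1) - Num.min s (p i)) =
  g i.+1 - g i by rewrite /g; lra.
rewrite -scalerBr -mulrBr normrZ.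
have gi : 0 <= g i.+1 - g i.
  rewrite /g !minEle; case: ifPn; case: ifPn; case: ifPn; case: ifPn;
  rewrite -?ltNge => *; lra.
rewrite ger0_norm// mulrC.
have [->|gi0] := eqVneq (g i.+1 - g i) 0; first by rewrite !mulr0.
rewrite ler_pM2r ?lt_neqAle 1?eq_sym ?gi0//.
have pit : p i <= t.
  rewrite leNgt; apply/negP => h; case/negP: gi0; apply/eqP.
  rewrite /g !(@min_l _ _ t) ?(@min_l _ _ s); lra.
have spi : s <= p i.+1.
  rewrite leNgt; apply/negP => h; case/negP: gi0; apply/eqP.
  rewrite /g !(@min_r _ _ t) ?(@min_r _ _ s); lra.
have /andP[api pib] := grid_in (ltnW ni); rewrite -/(p i) in api pib.
(* The overlap is nonzero, so either [p i] lies in [[s, t]], or the cell straddles [s] and [f (p i)]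
   is [w]-close to [f s]. *)
have [h|h] := leP s (p i).
  rewrite distrC (le_trans (Hv _ _)) ?h// lerDl.
  (* This instance only provides [0 <= w]. *)
  have := Hw a a; rewrite lexx ab !subrr !normr0; apply => //.
  by rewrite divr_ge0// subr_ge0.
rewrite distrC (le_trans (ler_distD (f s) _ _))// addrC lerD//.
  by apply: Hv; rewrite lexx.
by apply: Hw; rewrite ?api// -pii ler0_norm; lra.
Qed.

(** A common refinement is avoided: on each cell of the grid [n], [step_estimate] for the grid [m]
    applies with [v = f (p i)], which is [w]-close to [f] on that cell. *)
Let step_cauchy n m t (w : R) : a <= t <= b -> small_mesh n w -> small_mesh m w ->
  `|step_primitive n t - step_primitive m t| <= (w + w) * (t - a).
Proof.
move=> /andP[at_ tb] Hn Hm; pose p := grid a b n.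
have q0 : Num.min t (p 0%N) = a by rewrite /p grid0 min_r.
have qn : Num.min t (p n.+1) = t by rewrite /p gridn min_l.
have Gm0 : step_primitive m a = 0.
  rewrite /step_primitive big1// => i _.
  have /andP[h1 _] := grid_in (ltnW (ltn_ord i)).
  have /andP[h2 _] := grid_in (ltn_ord i).
  by rewrite !min_l// subrr scale0r.
have -> : step_primitive m t =
    step_primitive m (Num.min t (p n.+1)) - step_primitive m (Num.min t (p 0%N)).
  by rewrite q0 qn Gm0 subr0.
rewrite (telescope_vec n.+1 (fun i => step_primitive m (Num.min t (p i)))) -sumrB.
have -> : (w + w) * (t - a) =
    (w + w) * Num.min t (p n.+1) - (w + w) * Num.min t (p 0%N).
  by rewrite q0 qn mulrBr.
apply: (@sum_telescope_le _ _ _ (fun i => (Num.min t (p i.+1) - Num.min t (p i)) *: f (p i) -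
  (step_primitive m (Num.min t (p i.+1)) - step_primitive m (Num.min t (p i))))
  (fun i => (w + w) * Num.min t (p i))) => i ni.
have pi : p i <= p i.+1 by exact: gridS_ge0.
have pii : p i.+1 - p i = (b - a) / n.+1%:R by exact: gridS.
have /andP[api pib] := grid_in (ltnW ni); rewrite -/(p i) in api pib.
have [h|h] := leP t (p i).
  by rewrite (min_l (le_trans h pi)) subrr scale0r !subrr normr0.
rewrite -mulrBr; apply: step_estimate => //.
- by rewrite le_min (ltW h).
- by rewrite ge_min tb.
- move=> u /andP[piu]; rewrite le_min => /andP[_ h'].
  by rewrite distrC; apply: Hn; rewrite ?api// -pii ler0_norm; lra.
Qed.

(** A mean value estimate with a free vector [v]: [v = f s] yields the derivative of [G], and
    [v = 0] its Lipschitz bound. One [e] is the distance from [f] to [v], the other an upper bound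
    on the mesh error. *)
Lemma primitive_exists : exists G : R -> V, G a = 0 /\
  forall s t v (e : R), a <= s -> s <= t -> t <= b -> 0 < e ->
    (forall u, s <= u <= t -> `|f u - v| <= e) ->
    `|(t - s) *: v - (G t - G s)| <= (e + e) * (t - s).
Proof.
have G_ex t : exists l : V, a <= t <= b -> step_primitive n t @[n --> \oo] --> l.
  have [atb|] := boolP (a <= t <= b); last by exists 0.
  have [|l Hl] := @seq_complete R V (step_primitive ^~ t); last by exists l.
  move=> e e0; pose w := e / 4 / (b - a + 1).
  have ba0 : 0 < b - a + 1 by rewrite ltr_wpDl ?subr_ge0.
  have w0 : 0 < w by rewrite !divr_gt0.
  have [N _ HN] := small_mesh_near w0.
  exists N => m Nm; rewrite (le_lt_trans (step_cauchy atb (HN _ Nm) (HN _ (leqnn _))))//.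
  apply: (@le_lt_trans _ _ ((w + w) * (b - a + 1))).
    rewrite ler_pM2l ?addr_gt0//; case/andP: atb; lra.
  by rewrite /w -mulrDl divfK ?gt_eqF//; lra.
have [G HG] := choice G_ex.
have Ga : G a = 0.
  apply: (cvg_unique _ (HG a _)) => //; first by rewrite lexx ab.
  rewrite (_ : step_primitive ^~ a = cst 0); first exact: cvg_cst.
  apply/funext => n; rewrite /step_primitive big1// => i _.
  have /andP[h1 _] := grid_in (ltnW (ltn_ord i)).
  have /andP[h2 _] := grid_in (ltn_ord i).
  by rewrite !min_l// subrr scale0r.
exists G; split => // s t v e as_ st tb e0 Hv.
have cs : step_primitive n s @[n --> \oo] --> G s.
  by apply: HG; rewrite as_ (le_trans st).
have ct : step_primitive n t @[n --> \oo] --> G t.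
  by apply: HG; rewrite tb (le_trans as_).
have cst' : (t - s) *: v - (step_primitive n t - step_primitive n s) @[n --> \oo] -->
    (t - s) *: v - (G t - G s) by apply: cvgB; [exact: cvg_cst|exact: cvgB].
apply: (cvg_norm_le cst'); have := small_mesh_near e0; apply: filterS => n Hn.
exact: step_estimate.
Qed.

End Primitive.

Lemma is_Rint_continuous (R : realType) (V : completeNormedModType R) (f : R -> V)
    (a b : R) (G : R -> V) : continuous f ->
  (forall s t v (e : R), a <= s -> s <= t -> t <= b -> 0 < e ->
    (forall u, s <= u <= t -> `|f u - v| <= e) ->
    `|(t - s) *: v - (G t - G s)| <= (e + e) * (t - s)) ->
  is_Rint f a b (G b - G a).
Proof.
move=> cf HG; apply: is_Rint_primitive => e e0.
have e2 : 0 < e / 2 by rewrite divr_gt0.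
have [r r0 Hr] := uniformly_continuous_itv a b cf e2.
exists r => // s x t as_ sx xt tb tsr; rewrite {1}(splitr e).
apply: HG => //; first exact: le_trans xt.
move=> u /andP[su ut]; apply: Hr; first by rewrite in_itv/=; lra.
by rewrite ltr_distl; lra.
Qed.

(** * C0 semigroups *)

Section BoundedLinear.
Context (R : realType) (V W : normedModType R) (K : V -> W).
Hypothesis lK : linear K.

Definition lin_of : {linear V -> W} := HB.pack K (GRing.isLinear.Build _ _ _ _ _ lK).

Lemma linear_map0 : K 0 = 0. Proof. exact: (linear0 lin_of). Qed.
Lemma linear_mapB x y : K (x - y) = K x - K y. Proof. exact: (linearB lin_of). Qed.
Lemma linear_mapD x y : K (x + y) = K x + K y. Proof. exact: (linearD lin_of). Qed.
Lemma linear_mapZ a x : K (a *: x) = a *: K x. Proof. exact: (linearZ_LR lin_of). Qed.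

Lemma linear_continuous_bound : continuous K ->
  exists2 C : R, 0 < C & forall x, `|K x| <= C * `|x|.
Proof.
move=> cK; have /linear_boundedP/pinfty_ex_gt0[C C0 HC] :=
  @continuous_linear_bounded R V W 0 lin_of (cK 0).
by exists C.
Qed.

Lemma linear_bound_continuous (C : R) : (forall x, `|K x| <= C * `|x|) -> continuous K.
Proof.
move=> HC; apply: (@bounded_linear_continuous _ _ _ lin_of); apply/linear_boundedP.
by near=> r => x; rewrite (le_trans (HC x))// ler_wpM2r.
Unshelve. all: by end_near. Qed.

Lemma is_Rint_linear (f : R -> V) (a b : R) z :
  continuous K -> is_Rint f a b z -> is_Rint (fun s => K (f s)) a b (K z).
Proof. by move=> cK fz; exact: (@is_Rint_map _ _ _ lin_of). Qed.

End BoundedLinear.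

(** Orbits are controlled on each [[0, t0]] only; freezing them at [0] makes them continuous on the
    whole line, as the lemmas on integrals require. *)
Lemma clamp_continuous (R : realType) (V : normedModType R) (f : R -> V) :
  (forall t0 e : R, 0 < e -> exists2 d : R, 0 < d &
    forall s t, 0 <= s <= t0 -> 0 <= t <= t0 -> `|s - t| < d -> `|f s - f t| <= e) ->
  continuous (fun t : R => f (Num.max 0 t)).
Proof.
move=> cf t; apply/cvgrPdist_le => e e0; have [d d0 Hd] := cf (`|t| + 1) e e0.
exists (Num.min d 1) => /=; first by rewrite lt_min d0 ltr01.
move=> s /=; rewrite lt_min => /andP[std st1].
have st : `|Num.max 0 t - Num.max 0 s| <= `|t - s|.
  have h1 := ler_norm (t - s); have h2 := ler_norm (s - t); rewrite distrC in h2.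
  rewrite !maxEle ler_norml; apply/andP.
  by case: ifPn; case: ifPn; rewrite -?ltNge => h3 h4; split; lra.
apply: Hd; last exact: le_lt_trans std.
  by rewrite le_max lexx/= ge_max ler_wpDl//= (le_trans (ler_norm _))// lerDl.
rewrite le_max lexx/= ge_max ler_wpDl//=.
have := ler_norm (s - t); rewrite distrC; have := ler_norm t; lra.
Qed.

Section SemigroupBounds.
Context (R : realType) (V : completeNormedModType R) (S : R -> V -> V).
Hypothesis hS : C0_semigroup S.

Let S_near0 x (e : R) : 0 < e ->
  exists2 d : R, 0 < d & forall t : R, 0 <= t -> t < d -> `|S t x - x| <= e.
Proof.
move=> e0; have /cvgrPdist_le/(_ e e0)[d /= d0 Hd] := @C0_cvg _ _ _ hS x.
exists d => // t; rewrite le_eqVlt => /predU1P[<- _|t0 td].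
  by rewrite (C0_id hS) subrr normr0 ltW.
by rewrite distrC; apply: Hd => //=; rewrite sub0r normrN gtr0_norm.
Qed.

(** Otherwise some [t n] tending to [0] have norms of [S (t n)] exceeding [n.+1]; but [S (t n) x]
    converges to [x] for each [x], against the uniform boundedness principle. *)
Let bound_near0 : exists2 d : R, 0 < d & exists2 M : R, 1 <= M &
  forall (t : R) x, 0 <= t -> t <= d -> `|S t x| <= M * `|x|.
Proof.
apply: contrapT => H.
have /choice[t Ht] : forall n : nat, exists t : R, 0 <= t <= n.+1%:R^-1 /\
    exists x, n.+1%:R * `|x| < `|S t x|.
  move=> n; apply: contrapT => Hn; apply: H; exists n.+1%:R^-1 => //.
  exists n.+1%:R; first by rewrite ler1n.
  move=> t x t0 tn; rewrite leNgt; apply/negP => Hx; apply: Hn.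
  by exists t; split; [rewrite t0|exists x].
have tcvg x : S (t n) x @[n --> \oo] --> x.
  apply/cvgrPdist_le => e e0; have [d d0 Hd] := S_near0 x e0.
  have := mesh_cvg0 0 1 d0; apply: filterS => n; rewrite subr0 mul1r => nd.
  have [/andP[tn0 tn1] _] := Ht n.
  by rewrite distrC; apply: Hd => //; exact: le_lt_trans nd.
pose F := range (fun n => S (t n)).
have tn0 n : 0 <= t n by have [/andP[]] := Ht n.
have F1 f : F f -> bounded_fun_norm f /\ linear f.
  move=> [n _ <-]; split; last exact: (C0_linear hS).
  have [C C0 HC] := linear_continuous_bound (C0_linear hS (tn0 n)) (C0_bounded hS (tn0 n)).
  by move=> r; exists (C * r) => x xr; rewrite (le_trans (HC x))// ler_pM2l.
have F2 : pointwise_bounded F.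
  move=> x; have /cvg_seq_bounded/pinfty_ex_gt0[M M0 HM] : cvg (S (t n) x @[n --> \oo]).
    by apply/cvg_ex; exists x.
  by exists M => f [n _ <-]; exact: HM.
have [M HM] := Banach_Steinhauss F1 F2 1.
have [n Mn] : exists n : nat, M <= n.+1%:R.
  have [n Hn] : exists n : nat, M < n%:R.
    by exists (Num.bound `|M|); rewrite (le_lt_trans (ler_norm _))// archi_boundP.
  by exists n; rewrite (le_trans (ltW Hn))// ler_nat.
have [_ [x Hx]] := Ht n.
have x0 : 0 < `|x|.
  rewrite normr_gt0; apply/eqP => x0; move: Hx.
  by rewrite x0 (linear_map0 (C0_linear hS (tn0 n))) !normr0 mulr0 ltxx.
have := HM (S (t n)) (ex_intro2 _ _ n I erefl) (`|x|^-1 *: x).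
rewrite (linear_mapZ (C0_linear hS (tn0 n))) !normrZ normfV normr_id mulVf ?gt_eqF//.
move=> /(_ (lexx _)); rewrite mulrC ler_pdivrMr// => h.
have : n.+1%:R * `|x| < M * `|x| by exact: lt_le_trans Hx h.
by rewrite ltr_pM2r// ltNge Mn.
Qed.

(** Time is cut into steps of length [d], each costing a factor [M]; [1 <= M] makes the bound
    increase with the number of steps. *)
Lemma semigroup_bound (t0 : R) : exists2 M : R, 1 <= M &
  forall (t : R) x, 0 <= t -> t <= t0 -> `|S t x| <= M * `|x|.
Proof.
have [d d0 [M M1 HM]] := bound_near0.
have M0 : 0 <= M by exact: le_trans M1.
have Hk (k : nat) t x : 0 <= t -> t <= d *+ k -> `|S t x| <= M ^+ k * `|x|.
  elim: k t x => [|k IH] t x t0' tk.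
    have -> : t = 0 by apply/eqP; rewrite eq_le t0' andbT -(mulr0n d).
    by rewrite (C0_id hS) expr0 mul1r.
  have [td|dt] := leP t d.
    rewrite (le_trans (HM _ _ t0' td))// ler_wpM2r// -[leLHS]expr1.
    by rewrite ler_weXn2l.
  have td0 : 0 <= t - d by rewrite subr_ge0 ltW.
  have tdk : t - d <= d *+ k by rewrite lerBlDr -mulrSr.
  rewrite -(subrK d t) (C0_comp hS x td0 (ltW d0)) (le_trans (IH _ _ td0 tdk))//.
  by rewrite exprSr -mulrA ler_wpM2l ?exprn_ge0//; apply: HM => //; exact: ltW.
exists (M ^+ Num.bound `|t0 / d|); first exact: exprn_ege1.
move=> t x t1 tt0; apply: Hk => //; rewrite (le_trans tt0)//.
rewrite -mulr_natl -ler_pdivrMr// ltW// (le_lt_trans (ler_norm _))//.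
exact: archi_boundP.
Qed.

(** Right continuity at [0] is transported by [S t x - S s x = S s (S (t - s) x - x)] and the local
    bound on [S s]. *)
Lemma semigroup_ucontinuous x (t0 e : R) : 0 < e -> exists2 d : R, 0 < d &
  forall s t, 0 <= s <= t0 -> 0 <= t <= t0 -> `|s - t| < d -> `|S s x - S t x| <= e.
Proof.
move=> e0; have [M M1 HM] := semigroup_bound t0.
have M0 : 0 < M by exact: lt_le_trans M1.
have [d d0 Hd] := S_near0 x (divr_gt0 e0 M0); exists d => // s t.
wlog st : s t / s <= t.
  move=> H hs ht; have [/H|/ltW/H] := leP s t; first exact.
  by rewrite distrC (distrC (S s x)); exact.
move=> /andP[s0 s1] /andP[t1 t2] std.
have ts0 : 0 <= t - s by rewrite subr_ge0.
have -> : S t x = S s (S (t - s) x) by rewrite -(C0_comp hS)// addrC subrK.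
rewrite distrC -(linear_mapB (C0_linear hS s0)) (le_trans (HM _ _ _ _))// mulrC -ler_pdivlMr//.
by apply: Hd => //; rewrite distrC ger0_norm in std.
Qed.

Lemma semigroup_continuous (x : V) : continuous (fun t : R => S (Num.max 0 t) x).
Proof.
by apply: (@clamp_continuous _ _ (S ^~ x)) => t0 e; exact: semigroup_ucontinuous.
Qed.

End SemigroupBounds.

(** * Real inner products compatible with the norm *)

Record inner_product (R : realType) (V : normedModType R) (ip : V -> V -> R) : Prop := {
  ipC : forall x y, ip x y = ip y x ;
  ip_linear : forall y, linear (ip ^~ y : V -> R^o) ;
  ip_norm : forall x, ip x x = `|x| ^+ 2 }.

Section InnerProduct.
Context (R : realType) (V : normedModType R) (ip : V -> V -> R).
Hypothesis hip : inner_product ip.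

Lemma ip0l y : ip 0 y = 0. Proof. exact: linear_map0 (ip_linear hip y). Qed.
Lemma ip0r y : ip y 0 = 0. Proof. by rewrite ipC// ip0l. Qed.
Lemma ipDl x x' y : ip (x + x') y = ip x y + ip x' y.
Proof. exact: linear_mapD (ip_linear hip y) x x'. Qed.
Lemma ipBl x x' y : ip (x - x') y = ip x y - ip x' y.
Proof. exact: linear_mapB (ip_linear hip y) x x'. Qed.
Lemma ipZl a x y : ip (a *: x) y = a * ip x y.
Proof. exact: linear_mapZ (ip_linear hip y) a x. Qed.
Lemma ipDr x x' y : ip y (x + x') = ip y x + ip y x'.
Proof. by rewrite ipC// ipDl !(ipC hip y). Qed.
Lemma ipBr x x' y : ip y (x - x') = ip y x - ip y x'.
Proof. by rewrite ipC// ipBl !(ipC hip y). Qed.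
Lemma ipZr a x y : ip y (a *: x) = a * ip y x.
Proof. by rewrite ipC// ipZl (ipC hip y). Qed.

Lemma sqr_normD x y : `|x + y| ^+ 2 = `|x| ^+ 2 + 2 * ip x y + `|y| ^+ 2.
Proof. by rewrite -!(ip_norm hip) ipDl !ipDr (ipC hip y x); lra. Qed.

Lemma sqr_normB x y : `|x - y| ^+ 2 = `|x| ^+ 2 - 2 * ip x y + `|y| ^+ 2.
Proof. by rewrite -!(ip_norm hip) ipBl !ipBr (ipC hip y x); lra. Qed.

Lemma ip_le x y : ip x y <= `|x| * `|y|.
Proof.
have [->|x0] := eqVneq x 0; first by rewrite ip0l normr0 mul0r.
have [->|y0] := eqVneq y 0; first by rewrite ip0r normr0 mulr0.
have xy0 : 0 < `|x| * `|y| by rewrite mulr_gt0 ?normr_gt0.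
(* Expanding this square gives [2 |x| |y| (|x| |y| - ip x y) >= 0]. *)
have := sqr_ge0 `| `|y| *: x + (- `|x|) *: y|.
rewrite sqr_normD ipZl ipZr !normrZ normrN !normr_id => h.
rewrite -(ler_pM2l xy0); nra.
Qed.

Lemma CauchySchwarz x y : `|ip x y| <= `|x| * `|y|.
Proof.
rewrite ler_norml ip_le andbT lerNl -mulN1r -ipZl scaleN1r.
by rewrite (le_trans (ip_le _ _))// normrN.
Qed.

Lemma ip_continuous y : continuous (ip ^~ y : V -> R^o).
Proof.
apply: (linear_bound_continuous (ip_linear hip y) (C := `|y|)) => x.
by rewrite mulrC; exact: CauchySchwarz.
Qed.

End InnerProduct.

(** * Generators: invariance and density of the domain *)

Section Generator.
Context (R : realType) (V : completeNormedModType R) (A : set (V * V)).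
Variable S : R -> V -> V.
Hypothesis hA : generates A S.

Let hS : C0_semigroup S. Proof. by case: hA. Qed.

Lemma generator_quotient x z : A (x, z) <-> forall e : R, 0 < e ->
  \forall h \near 0^'+, `|S h x - x - h *: z| <= e * h.
Proof.
have h0 : \forall h \near (0 : R)^'+, 0 < h by exact: nbhs_right_gt.
have eqE (h : R) : 0 < h -> `|z - h^-1 *: (S h x - x)| = h^-1 * `|S h x - x - h *: z|.
  move=> hgt0; rewrite -[in RHS](gtr0_norm (_ : 0 < h^-1)) ?invr_gt0// -normrZ.
  by rewrite [in RHS]scalerBr scalerA mulVf ?gt_eqF// scale1r distrC.
rewrite (hA.2 x z); split=> [/cvgrPdist_le H e e0|H].
  have := H e e0; apply: filterS2 h0 => h hgt0.
  by rewrite eqE// ler_pdivrMl// mulrC.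
apply/cvgrPdist_le => e e0; have := H e e0; apply: filterS2 h0 => h hgt0.
by rewrite eqE// ler_pdivrMl// mulrC.
Qed.

(* Bounded operators commuting with the semigroup preserve its generator. *)
Lemma generator_commute (K : V -> V) x z : linear K -> continuous K ->
  (forall t y, 0 <= t -> K (S t y) = S t (K y)) -> A (x, z) -> A (K x, K z).
Proof.
move=> lK cK KS /generator_quotient Ax; apply/generator_quotient => e e0.
have [C C0 HC] := linear_continuous_bound lK cK.
have h0 : \forall h \near (0 : R)^'+, 0 < h by exact: nbhs_right_gt.
have := Ax (e / C) (divr_gt0 e0 C0); apply: filterS2 h0 => h hgt0 H.
rewrite -(KS _ _ (ltW hgt0)) -(linear_mapZ lK) -!(linear_mapB lK) (le_trans (HC _))//.
by rewrite mulrC -ler_pdivlMr// mulrAC.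
Qed.

Lemma generator_S t x z : 0 <= t -> A (x, z) -> A (S t x, S t z).
Proof.
move=> t0; apply: generator_commute; [exact: (C0_linear hS)|exact: (C0_bounded hS)|].
by move=> s y s0; rewrite -!(C0_comp hS)// addrC.
Qed.

(** With [G h] the integral of [S t x] over [[0, h]], the mean [h^-1 *: G h] tends to [x] and lies
    in the domain, with image [h^-1 *: (S h x - x)]. *)
Lemma generator_dense x (e : R) : 0 < e -> exists z z', A (z, z') /\ `|x - z| <= e.
Proof.
move=> e0; pose f (t : R) := S (Num.max 0 t) x.
have cf : continuous f by exact: semigroup_continuous.
have fS t : 0 <= t -> f t = S t x by move=> t0; rewrite /f max_r.
(* Times [h + k] with [h, k < 1] occur below, hence the interval [[0, 2]]. *)
have le02 : (0 : R) <= 2 by [].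
have [G [G0 HG]] := primitive_exists le02 cf.
have [M M1 HM] := semigroup_bound hS 2.
have M0 : 0 < M by exact: lt_le_trans M1.
have f0 : f 0 = x by rewrite fS// (C0_id hS).
have fnear s (e' : R) : 0 <= s -> s < 2 -> 0 < e' ->
    \forall h \near 0^'+, `|h *: f s - (G (s + h) - G s)| <= e' * h.
  move=> s0 s2 e'0.
  have e'2 : 0 < e' / 2 by rewrite divr_gt0.
  have [r r0 Hr] := uniformly_continuous_itv 0 2 cf e'2.
  have n1 : \forall h \near 0^'+, h < Num.min r (2 - s).
    by apply: nbhs_right_lt; rewrite lt_min r0 subr_gt0.
  have n2 : \forall h \near (0 : R)^'+, 0 < h by exact: nbhs_right_gt.
  apply: filterS2 n1 n2 => h; rewrite lt_min => /andP[hr hs] h0.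
  have {1}-> : h = (s + h) - s by rewrite addrC addKr.
  rewrite (le_trans (HG s (s + h) (f s) (e' / 2) _ _ _ _ _))//.
  - by rewrite lerDl ltW.
  - lra.
  - move=> u /andP[su ush]; apply: Hr; first by rewrite in_itv/=; lra.
    by rewrite ltr_distl; lra.
  - by rewrite -splitr; lra.
have Glip s t : 0 <= s -> s <= t -> t <= 2 -> `|G t - G s| <= (M * `|x| + 1) *+ 2 * (t - s).
  move=> s0 st t2; have := HG s t 0 (M * `|x| + 1) s0 st t2.
  rewrite scaler0 sub0r normrN mulr2n; apply; first by rewrite ltr_wpDl ?mulr_ge0// ltW.
  move=> u /andP[su ut]; rewrite subr0 fS ?(le_trans s0)//.
  by rewrite (le_trans (HM _ _ _ _)) ?lerDl// ?(le_trans s0)// (le_trans ut).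
(* As functions of the upper limit [h], both sides have right derivative [f (h + k) = S k (f h)] and
   both vanish at [0]. *)
have SG h k : 0 <= h -> h < 1 -> 0 < k -> k < 1 -> S k (G h) = G (h + k) - G k.
  move=> h0 h1 k0 k1; apply/eqP; rewrite -subr_eq0.
  pose F s := S k (G s) - (G (s + k) - G k).
  have k0' := ltW k0.
  suff /eqP : F h = F 0.
    by rewrite /F add0r G0 (linear_map0 (C0_linear hS k0')) subrr subr0.
  have HMk y : `|S k y| <= M * `|y| by apply: HM => //; lra.
  have FB s t : F s - F t = S k (G s - G t) - (G (s + k) - G (t + k)).
    rewrite /F (linear_mapB (C0_linear hS k0')); move: (S k (G s)) (S k (G t)) => a b.
    by rewrite !opprB [_ - _ - b]addrC addrACA [X in _ + X]addrC subrKA.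
  apply: (right_derive0_eq h0).
    move=> c /andP[c0 ch] e' e'0.
    pose C := (M * `|x| + 1) *+ 2.
    have C0 : 0 < C by rewrite pmulrn_lgt0// ltr_wpDl ?mulr_ge0// ltW.
    have Glip' s t : 0 <= s <= 2 -> 0 <= t <= 2 -> `|G t - G s| <= C * `|t - s|.
      move=> /andP[s0 s2] /andP[t0 t2]; have [st|ts] := leP s t.
        by rewrite ger0_norm ?subr_ge0// Glip.
      by rewrite distrC (distrC t) ger0_norm ?subr_ge0 ?(ltW ts)// Glip// ltW.
    have MC : 0 < (M + 1) * C by rewrite mulr_gt0// addr_gt0.
    exists (e' / ((M + 1) * C)); first by rewrite divr_gt0.
    move=> s /andP[s0 sh]; rewrite ltr_pdivlMr// => sc.
    rewrite FB (le_trans (ler_normB _ _))// (le_trans _ (ltW sc))//.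
    rewrite mulrC mulrAC mulrDl mul1r mulrDl lerD//.
      rewrite (le_trans (HMk _))// -mulrA ler_pM2l// mulrC.
      by apply: Glip'; lra.
    have -> : s - c = (s + k) - (c + k) by lra.
    by rewrite mulrC; apply: Glip'; lra.
  move=> s /andP[s0 sh] e' e'0.
  have e1 : 0 < e' / (M + 1) by rewrite divr_gt0// addr_gt0.
  have n1 := fnear s _ s0 (lt_trans sh (lt_trans h1 (ltr1n R 2))) e1.
  have sk0 : 0 <= s + k by rewrite addr_ge0.
  have n2 := fnear (s + k) _ sk0 _ e1.
  have {}n2 := n2 (ltac:(lra)).
  have n3 : \forall h \near (0 : R)^'+, 0 < h by exact: nbhs_right_gt.
  apply: filterS3 n1 n2 n3 => u H1 H2 u0.
  rewrite FB; have -> : s + u + k = s + k + u by lra.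
  have E : u *: f (s + k) = S k (u *: f s).
    by rewrite (linear_mapZ (C0_linear hS k0')) !fS// -(C0_comp hS)// addrC.
  rewrite -normrN opprB.
  have -> : G (s + k + u) - G (s + k) - S k (G (s + u) - G s) =
     S k (u *: f s - (G (s + u) - G s)) - (u *: f (s + k) - (G (s + k + u) - G (s + k))).
    rewrite (linear_mapB (C0_linear hS k0') (u *: f s)) E.
    by rewrite [RHS]addrC opprB subrKA.
  rewrite (le_trans (ler_normB _ _))//.
  have -> : e' * u = M * (e' / (M + 1) * u) + e' / (M + 1) * u.
    rewrite -[X in _ + X]mul1r -mulrDl mulrA mulrCA divff ?mulr1// gt_eqF// addr_gt0//.
  by rewrite lerD// (le_trans (HMk _))// ler_pM2l.
have n1 := fnear 0 e (lexx _) (ltr0n R 2) e0.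
have n2 : \forall h \near (0 : R)^'+, 0 < h by exact: nbhs_right_gt.
have n3 : \forall h \near (0 : R)^'+, h < 1 by exact: nbhs_right_lt.
have [h [[H1 h0] h1]] := filter_ex (filterI (filterI n1 n2) n3).
exists (h^-1 *: G h), (h^-1 *: (f h - x)); split; last first.
  move: H1; rewrite add0r G0 subr0 f0 => H1.
  rewrite -(ler_pM2l h0) -{1}(gtr0_norm h0) -normrZ scalerBr scalerA divff ?gt_eqF//.
  by rewrite scale1r mulrC.
apply/generator_quotient => e' e'0.
have e2 : 0 < e' * h / 2 by rewrite divr_gt0// mulr_gt0.
have m1 := fnear 0 _ (lexx _) (ltr0n R 2) e2.
have m2 := fnear h _ (ltW h0) (lt_trans h1 (ltr1n R 2)) e2.
have m3 : \forall h \near (0 : R)^'+, 0 < h by exact: nbhs_right_gt.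
have m4 : \forall h \near (0 : R)^'+, h < 1 by exact: nbhs_right_lt.
apply: filterS3 (filterI m1 m2) m3 m4 => k [K1 K2] k0 k1.
rewrite (linear_mapZ (C0_linear hS (ltW k0))) SG//; last exact: ltW.
rewrite [k *: (_ *: _)]scalerA mulrC -scalerA -!scalerBr normrZ gtr0_norm ?invr_gt0//.
rewrite ler_pdivrMl//.
rewrite add0r G0 subr0 f0 in K1.
(* By [SG], the increment [S k (G h) - G h] is the increment of [G] at [h] minus that at [0], of
   first order [k *: f h] and [k *: x]. *)
have -> : G (h + k) - G k - G h - k *: (f h - x) =
   (k *: x - G k) - (k *: f h - (G (h + k) - G h)).
  by rewrite scalerBr !opprB [_ - G k - G h]addrAC addrACA [RHS]addrACA [k *: x + _]addrC.
rewrite (le_trans (ler_normB _ _))//.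
have -> : h * (e' * k) = e' * h / 2 * k + e' * h / 2 * k by rewrite -mulrDl -splitr; ring.
exact: lerD.
Qed.

End Generator.

(** * Symmetric semigroups *)

Section SymmetricSemigroup.
Context (R : realType) (V : completeNormedModType R) (ip : V -> V -> R).
Context (A : set (V * V)) (S : R -> V -> V).
Hypotheses (hip : inner_product ip) (hA : generates A S).
Hypothesis A_sym : forall x x' y y', A (x, x') -> A (y, y') -> ip x' y = ip x y'.

Let hS : C0_semigroup S. Proof. by case: hA. Qed.

(* [ip (S s x) (S (t - s) y)] has zero right derivative in [s]. *)
Let semigroup_sym_dom t x x' y y' : 0 <= t -> A (x, x') -> A (y, y') ->
  ip (S t x) y = ip x (S t y).
Proof.
move=> t0 Ax Ay; have [M M1 HM] := semigroup_bound hS t.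
have M0 : 0 < M by exact: lt_le_trans M1.
have xy0 : 0 < `|x| + `|y| + 1 by rewrite ltr_wpDl.
pose C := M * (`|x| + `|y| + 1).
have C0 : 0 < C by rewrite mulr_gt0.
have Cn0 : C != 0 by rewrite gt_eqF.
have Cx s : 0 <= s <= t -> `|S s x| <= C.
  move=> /andP[s0 st]; rewrite (le_trans (HM _ _ s0 st))// ler_pM2l//.
  by have := normr_ge0 y; lra.
have Cy s : 0 <= s <= t -> `|S s y| <= C.
  move=> /andP[s0 st]; rewrite (le_trans (HM _ _ s0 st))// ler_pM2l//.
  by have := normr_ge0 x; lra.
pose phi s : R^o := ip (S s x) (S (t - s) y).
suff : phi t = phi 0 by rewrite /phi subrr subr0 !(C0_id hS).
have phiB s r : phi s - phi r =
    ip (S s x - S r x) (S (t - s) y) - ip (S r x) (S (t - r) y - S (t - s) y).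
  by rewrite (ipBl hip) (ipBr hip) /phi; lra.
apply: (right_derive0_eq t0).
  move=> c ct e e0; have eC : 0 < e / 2 / C by rewrite !divr_gt0.
  have [d d0 Hd] := semigroup_ucontinuous hS x t eC.
  have [d' d'0 Hd'] := semigroup_ucontinuous hS y t eC.
  exists (Num.min d d'); first by rewrite lt_min d0.
  move=> s st; rewrite lt_min => /andP[sc sc'].
  have ts : 0 <= t - s <= t by lra.
  have tc : 0 <= t - c <= t by lra.
  rewrite phiB (le_trans (ler_normB _ _))// (splitr e) lerD//.
    rewrite (le_trans (CauchySchwarz hip _ _))// -[leRHS](divfK Cn0).
    by rewrite ler_pM ?normr_ge0// ?Cy// Hd.
  rewrite (le_trans (CauchySchwarz hip _ _))// mulrC.
  rewrite -[leRHS](divfK Cn0) ler_pM ?normr_ge0// ?Cx// Hd'//.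
  by have -> : t - c - (t - s) = s - c by lra.
move=> s /andP[s0 st] e e0.
have eC : 0 < e / 2 / (M * C) by rewrite !divr_gt0// mulr_gt0.
have n1 := (generator_quotient hA x x').1 Ax _ eC.
have n2 := (generator_quotient hA y y').1 Ay _ eC.
have n3 : \forall h \near (0 : R)^'+, 0 < h by exact: nbhs_right_gt.
have n4 : \forall h \near (0 : R)^'+, h < t - s by apply: nbhs_right_lt; lra.
apply: filterS3 (filterI n1 n2) n3 n4 => h [H1 H2] h0 hts.
pose r := t - (s + h); have r0 : 0 <= r by rewrite /r; lra.
have st' : s <= t by exact: ltW.
have rt : r <= t by rewrite /r; lra.
have Ex : S (s + h) x - S s x = S s (S h x - x).
  by rewrite (C0_comp hS)// ?(ltW h0)// (linear_mapB (C0_linear hS s0)).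
have Ey : S (t - s) y - S r y = S r (S h y - y).
  have -> : t - s = r + h by rewrite /r; lra.
  by rewrite (C0_comp hS)// ?(ltW h0)// (linear_mapB (C0_linear hS r0)).
rewrite phiB -/r Ex Ey.
(* The first-order terms cancel: [S] preserves the domain, so the symmetry of [A] applies to [S s x]
   and [S r y]. *)
have E := A_sym (generator_S hA s0 Ax) (generator_S hA r0 Ay).
have -> : ip (S s (S h x - x)) (S r y) - ip (S s x) (S r (S h y - y)) =
    ip (S s (S h x - x - h *: x')) (S r y) - ip (S s x) (S r (S h y - y - h *: y')).
  rewrite (linear_mapB (C0_linear hS s0) _ (h *: x')).
  rewrite (linear_mapB (C0_linear hS r0) _ (h *: y')).
  rewrite (linear_mapZ (C0_linear hS s0)) (linear_mapZ (C0_linear hS r0)).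
  by rewrite (ipBl hip (S s _)) (ipBr hip (S r _)) (ipZl hip) (ipZr hip) E; lra.
rewrite (le_trans (ler_normB _ _))//.
have -> : e * h = M * (e / 2 / (M * C) * h) * C + C * (M * (e / 2 / (M * C) * h)).
  by field; rewrite !gt_eqF.
rewrite lerD// (le_trans (CauchySchwarz hip _ _))// ler_pM//.
- by rewrite (le_trans (HM _ _ s0 st'))// ler_pM2l.
- by rewrite Cy// r0.
- by rewrite Cx// s0.
- by rewrite (le_trans (HM _ _ r0 rt))// ler_pM2l.
Qed.

(** The defect [ip (S t a) b - ip a (S t b)] is a bilinear form bounded by [2 M |a| |b|] and
    vanishes on the dense domain. *)
Lemma semigroup_sym t x y : 0 <= t -> ip (S t x) y = ip x (S t y).
Proof.
move=> t0; have [M M1 HM] := semigroup_bound hS t.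
have M0 : 0 < M by exact: lt_le_trans M1.
apply/eqP; rewrite -subr_eq0 -normr_le0; apply/ler_addgt0Pr => e e0; rewrite add0r.
pose C := 2 * M * (`|x| + `|y| + 1).
have C0 : 0 < C by rewrite !mulr_gt0// ltr_wpDl.
(* The bound [1] keeps [|v| <= |y| + 1]; the total error is then at most [d * C]. *)
pose d := Num.min 1 (e / C); have d0 : 0 < d by rewrite lt_min ltr01 divr_gt0.
have [u [u' [Au xu]]] := generator_dense hA x d0.
have [v [v' [Av yv]]] := generator_dense hA y d0.
have uv := semigroup_sym_dom t0 Au Av.
have v1 : `|v| <= `|y| + 1.
  rewrite -(subrK y v) addrC (le_trans (ler_normD _ _))// lerD2l distrC.
  by rewrite (le_trans yv)// ge_min lexx.
have tt := lexx t.
have -> : ip (S t x) y - ip x (S t y) = (ip (S t x) (y - v) - ip x (S t (y - v))) +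
    (ip (S t (x - u)) v - ip (x - u) (S t v)).
  rewrite !(linear_mapB (C0_linear hS t0)) !(ipBl hip) !(ipBr hip) uv; lra.
have B a b : `|ip (S t a) b - ip a (S t b)| <= 2 * M * (`|a| * `|b|).
  rewrite (le_trans (ler_normB _ _))//.
  have -> : 2 * M * (`|a| * `|b|) = M * `|a| * `|b| + `|a| * (M * `|b|) by lra.
  rewrite lerD// (le_trans (CauchySchwarz hip _ _))//.
    by rewrite ler_wpM2r// HM.
  by rewrite ler_wpM2l// HM.
rewrite (le_trans (ler_normD _ _))//.
apply: (@le_trans _ _ (2 * M * (`|x| * d) + 2 * M * (d * (`|y| + 1)))).
  rewrite lerD// (le_trans (B _ _))// ler_pM2l ?mulr_gt0//.
    by rewrite ler_wpM2l.
  by rewrite ler_pM.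
have -> : 2 * M * (`|x| * d) + 2 * M * (d * (`|y| + 1)) = d * C by rewrite /C; ring.
by rewrite -ler_pdivlMr// ge_min lexx orbT.
Qed.

(* For a symmetric semigroup [|S s z|^2 = <S (2s) z, z>] is midpoint convex in
   [s], hence lies above its tangent at [0]. *)
Lemma semigroup_tangent z z' s : A (z, z') -> 0 < s ->
  `|z| ^+ 2 + 2 * s * ip z' z <= `|S s z| ^+ 2.
Proof.
move=> Az s0.
pose g t := `|S t z| ^+ 2 - `|z| ^+ 2.
(* Insert [|S (t / 2) z|^2 = ip (S t z) z] into the expansion of [|S t z - z|^2 >= 0]. *)
have g_half t : 0 <= t -> 2 * g (t / 2) <= g t.
  move=> t0; have t20 : 0 <= t / 2 by rewrite divr_ge0.
  have : `|S (t / 2) z| ^+ 2 = ip (S t z) z.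
    by rewrite -(ip_norm hip) -semigroup_sym// -(C0_comp hS)// -splitr.
  have := sqr_ge0 `|S t z - z|.
  by rewrite (sqr_normB hip) /g; lra.
(* The quotients [g h / h] along [h = s / 2 ^+ n] stay below [g s / s], and their limit is
   [2 * ip z' z]. *)
have g_dyadic n : 2 ^+ n * g (s / 2 ^+ n) <= g s.
  elim: n => [|n IH]; first by rewrite expr0 divr1 mul1r.
  rewrite (le_trans _ IH)// exprSr -mulrA ler_pM2l ?exprn_gt0//.
  rewrite invfM mulrA; apply: g_half.
  by rewrite divr_ge0 ?exprn_ge0// ltW.
suff : 2 * s * ip z' z <= g s by rewrite /g; lra.
apply/ler_addgt0Pr => e e0.
(* Multiplied by [2 ^+ n = s / h], the resulting error on [g h] becomes [e |z| / (|z| + 1)], at most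
   [e] for every [n]. *)
have e1 : 0 < e / (2 * s * (`|z| + 1)) by rewrite divr_gt0// !mulr_gt0// ltr_wpDl.
have [d /= d0 Hd] := (generator_quotient hA z z').1 Az _ e1.
have [n Hn] : exists n : nat, s / 2 ^+ n < d.
  exists (Num.bound (s / d)); rewrite ltr_pdivrMr ?exprn_gt0// mulrC -ltr_pdivrMr//.
  rewrite (lt_trans (archi_boundP _)) ?divr_ge0 ?ltW//.
  by rewrite -natrX ltr_nat ltn_expl.
have h0 : 0 < s / 2 ^+ n by rewrite divr_gt0// exprn_gt0.
set h := s / 2 ^+ n in Hn h0.
have H : `|S h z - z - h *: z'| <= e / (2 * s * (`|z| + 1)) * h.
  by apply: Hd => //=; rewrite sub0r normrN gtr0_norm.
have gh : 2 * h * ip z' z - 2 * (e / (2 * s * (`|z| + 1)) * h * `|z|) <= g h.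
  rewrite /g -[in S h z](subrK z (S h z)) addrC (sqr_normD hip).
  have -> : S h z - z = (S h z - z - h *: z') + h *: z' by rewrite subrK.
  move: (S h z - z - h *: z') H => r H.
  have : - (e / (2 * s * (`|z| + 1)) * h * `|z|) <= ip r z.
    rewrite lerNl (le_trans (ler_norm _))// normrN (le_trans (CauchySchwarz hip _ _))//.
    exact: ler_wpM2r.
  have := sqr_ge0 `|r + h *: z'|; rewrite (ipDl hip) (ipZl hip); lra.
have := g_dyadic n; rewrite -/h -(ler_pM2l (_ : 0 < 2 ^+ n)) ?exprn_gt0// in gh *.
move=> gs; have hn : 2 ^+ n * h = s by rewrite /h mulrC divfK// gt_eqF// exprn_gt0.
have := le_trans gh gs; rewrite mulrBr.
have -> : 2 ^+ n * (2 * h * ip z' z) = 2 * s * ip z' z by rewrite -hn; ring.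
have -> : 2 ^+ n * (2 * (e / (2 * s * (`|z| + 1)) * h * `|z|)) = e * (`|z| / (`|z| + 1)).
  have z1 : `|z| + 1 != 0 by rewrite gt_eqF// ltr_wpDl.
  rewrite -hn; field; rewrite z1 ?hn !gt_eqF ?exprn_gt0//.
have : e * (`|z| / (`|z| + 1)) <= e.
  by rewrite ger_pMr// ler_pdivrMr ?ltr_wpDl// mul1r lerDl.
lra.
Qed.

End SymmetricSemigroup.

(** * Exponential of a bounded operator *)

(** The second-order remainder of the exponential, term by term. The upper bound is again an
    exponential coefficient, so it sums to an [expR]; the [1] in [t + h + 1] absorbs the extra
    summand of the induction, as [(t + h) X + X = (t + h + 1) X]. *)
Lemma exp_coeff_taylor (R : realType) (t h : R) n : 0 <= t -> 0 <= h ->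
  0 <= exp_coeff (t + h) n.+1 - exp_coeff t n.+1 - h * exp_coeff t n
    <= h ^+ 2 * exp_coeff (t + h + 1) n.
Proof.
move=> t0 h0.
have y0 : 0 <= t + h by rewrite addr_ge0.
have y1 : 0 <= t + h + 1 by rewrite addr_ge0.
have H k : 0 <= (t + h) ^+ k.+1 - t ^+ k.+1 - h * k.+1%:R * t ^+ k
     <= h ^+ 2 * k.+1%:R * (t + h + 1) ^+ k.
  elim: k => [|k /andP[IH1 IH2]].
    by rewrite !expr1 !expr0 !mulr1; have := sqr_ge0 h; lra.
  have -> : (t + h) ^+ k.+2 - t ^+ k.+2 - h * k.+2%:R * t ^+ k.+1 =
    (t + h) * ((t + h) ^+ k.+1 - t ^+ k.+1 - h * k.+1%:R * t ^+ k)
    + h ^+ 2 * k.+1%:R * t ^+ k.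
    by rewrite !exprS -!natr1; ring.
  have q0 : 0 <= h ^+ 2 * k.+1%:R by rewrite mulr_ge0// exprn_ge0.
  apply/andP; split; first by rewrite addr_ge0// mulr_ge0// exprn_ge0.
  have h1 : (t + h) * ((t + h) ^+ k.+1 - t ^+ k.+1 - h * k.+1%:R * t ^+ k) <=
      (t + h) * (h ^+ 2 * k.+1%:R * (t + h + 1) ^+ k) by rewrite ler_wpM2l.
  have h2 : h ^+ 2 * k.+1%:R * t ^+ k <= h ^+ 2 * k.+1%:R * (t + h + 1) ^+ k.
    by rewrite ler_wpM2l// lerXn2r ?nnegrE//; lra.
  rewrite (le_trans (lerD h1 h2))//.
  have -> : (t + h) * (h ^+ 2 * k.+1%:R * (t + h + 1) ^+ k) +
     h ^+ 2 * k.+1%:R * (t + h + 1) ^+ k = h ^+ 2 * k.+1%:R * (t + h + 1) ^+ k.+1.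
    by rewrite [X in _ = _ * X]exprS; ring.
  rewrite ler_wpM2r ?exprn_ge0// ler_wpM2l ?exprn_ge0//.
  by rewrite ler_nat.
have /andP[H1 H2] := H n.
have f0 : (n`!%:R : R) != 0 by rewrite pnatr_eq0 -lt0n fact_gt0.
have n0 : (n.+1%:R : R) != 0 by rewrite pnatr_eq0.
have -> : exp_coeff (t + h) n.+1 - exp_coeff t n.+1 - h * exp_coeff t n =
    ((t + h) ^+ n.+1 - t ^+ n.+1 - h * n.+1%:R * t ^+ n) / n.+1`!%:R.
  rewrite /exp_coeff/= factS natrM.
  move: (_ ^+ _) (t ^+ n.+1) (t ^+ n) n.+1%:R n0 n`!%:R f0 => p q r N N0 F F0.
  by field; rewrite N0 F0.
have -> : h ^+ 2 * exp_coeff (t + h + 1) n =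
    h ^+ 2 * n.+1%:R * (t + h + 1) ^+ n / n.+1`!%:R.
  rewrite /exp_coeff/= factS natrM.
  move: ((_ + 1) ^+ _) n.+1%:R n0 n`!%:R f0 => p N N0 F F0.
  by field; rewrite N0 F0.
have F0 : 0 < (n.+1`!%:R : R) by rewrite ltr0n fact_gt0.
by rewrite (divr_ge0 H1 (ltW F0)) ler_pM2r ?invr_gt0.
Qed.

Section OperatorExponential.
Context (R : realType) (V : completeNormedModType R) (B : V -> V) (b : R).
Hypotheses (lB : linear B) (b0 : 0 <= b) (HB : forall x, `|B x| <= b * `|x|).

Let term (t : R) (x : V) (n : nat) : V := exp_coeff t n *: iter n B x.

Definition expB (t : R) (x : V) : V := lim (series (term t x) n @[n --> \oo]).

Let iter_bound n x : `|iter n B x| <= b ^+ n * `|x|.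
Proof.
elim: n => [|n IH]; first by rewrite expr0 mul1r.
by rewrite iterS (le_trans (HB _))// exprS -mulrA ler_wpM2l.
Qed.

Let coeff_bound (c t : R) n x : `|c| <= exp_coeff t n ->
  `|c *: iter n B x| <= exp_coeff (t * b) n * `|x|.
Proof.
move=> ct; rewrite normrZ.
have -> : exp_coeff (t * b) n * `|x| = exp_coeff t n * (b ^+ n * `|x|).
  by rewrite /exp_coeff/= exprMn; ring.
by rewrite ler_pM.
Qed.

Let term_bound t x n : 0 <= t -> `|term t x n| <= exp_coeff (t * b) n * `|x|.
Proof. by move=> t0; apply: coeff_bound; rewrite ger0_norm// exp_coeff_ge0. Qed.

Let series_exp_le (y : R) n : 0 <= y -> series (exp_coeff y) n <= expR y.
Proof.
move=> y0; apply: nondecreasing_cvgn_le; last exact: is_cvg_series_exp_coeff.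
by apply: nondecreasing_series => k _ _; exact: exp_coeff_ge0.
Qed.

Lemma expB_cvg t x : 0 <= t -> series (term t x) n @[n --> \oo] --> expB t x.
Proof.
move=> t0; apply: normed_cvg.
have c := @is_cvg_seriesZ _ _ `|x| (is_cvg_series_exp_coeff (t * b)).
apply: series_le_cvg c => n //=.
  by rewrite mulr_ge0// exp_coeff_ge0// mulr_ge0.
by rewrite -[leRHS]mulrC; exact: term_bound.
Qed.

Arguments expB_cvg {t} x.

Lemma expB_linear t : 0 <= t -> linear (expB t).
Proof.
move=> t0 a x y; have lk k : linear (iter k B).
  by elim: k => [//|k IH] c u v; rewrite !iterS IH lB.
apply: (cvg_unique _ (expB_cvg _ t0)) => //.
have -> : series (term t (a *: x + y)) =
    (fun n => a *: series (term t x) n + series (term t y) n).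
  apply/funext => n; rewrite /series/= scaler_sumr -big_split; apply: eq_bigr => k _ /=.
  by rewrite /term lk scalerDr !scalerA mulrC.
by apply: cvgD; [apply: cvgZ; first exact: cvg_cst|]; exact: expB_cvg.
Qed.

Lemma expB0 x : expB 0 x = x.
Proof.
have c := expB_cvg x (lexx 0); rewrite -(cvg_shiftS (series (term 0 x))) in c.
apply: (cvg_unique _ c) => //; rewrite (_ : [sequence _]_n = cst x); first exact: cvg_cst.
apply/funext => n; rewrite /= /series/= big_nat_recl// big1_seq => [|k _].
  by rewrite /term/= /exp_coeff/= expr0 fact0 divr1 scale1r addr0.
by rewrite /term /exp_coeff/= expr0n/= mul0r scale0r.
Qed.

Lemma expB_bound t x : 0 <= t -> `|expB t x| <= expR (t * b) * `|x|.
Proof.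
move=> t0; apply: (cvg_norm_le (expB_cvg x t0)); apply: nearW => n.
rewrite (le_trans (ler_norm_sum _ _ _))//.
apply: (@le_trans _ _ (series (exp_coeff (t * b)) n * `|x|)).
  by rewrite /series/= mulr_suml; apply: ler_sum => k _; exact: term_bound.
by rewrite ler_wpM2r// series_exp_le// mulr_ge0.
Qed.

Lemma expB_continuous t : 0 <= t -> continuous (expB t).
Proof.
move=> t0; apply: (linear_bound_continuous (expB_linear t0)) => x.
exact: expB_bound.
Qed.

Lemma expB_commute (K : V -> V) t x : linear K -> continuous K ->
  (forall y, K (B y) = B (K y)) -> 0 <= t -> K (expB t x) = expB t (K x).
Proof.
move=> lK cK KB t0; apply: (cvg_unique _ _ (expB_cvg (K x) t0)) => //.
have -> : series (term t (K x)) = K \o series (term t x).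
  apply/funext => n; rewrite /series/= [RHS](linear_sum (lin_of lK)).
  apply: eq_bigr => k _ /=; rewrite /term (linear_mapZ lK); congr (_ *: _).
  by elim: k => [//|k IH]; rewrite !iterS KB IH.
apply: continuous_cvg; [exact: cK|exact: expB_cvg].
Qed.

Let expB_taylor t h x : 0 <= t -> 0 <= h ->
  `|expB (t + h) x - expB t x - h *: expB t (B x)| <=
  h ^+ 2 * (b * expR ((t + h + 1) * b)) * `|x|.
Proof.
move=> t0 h0; have y0 : 0 <= t + h by rewrite addr_ge0.
have y1 : 0 <= t + h + 1 by rewrite addr_ge0.
have c1 := expB_cvg x y0; have c2 := expB_cvg x t0.
(* The series at [x] are shifted by one, so that their term [k.+1] meets term [k] of the series at
   [B x]; the terms of index [0] cancel. *)
rewrite -(cvg_shiftS (series (term (t + h) x))) in c1.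
rewrite -(cvg_shiftS (series (term t x))) in c2.
have c3 : series (term (t + h) x) n.+1 - series (term t x) n.+1 -
    h *: series (term t (B x)) n @[n --> \oo] -->
    expB (t + h) x - expB t x - h *: expB t (B x).
  by apply: cvgB; [exact: cvgB|apply: cvgZ; [exact: cvg_cst|exact: expB_cvg]].
apply: (cvg_norm_le c3); apply: nearW => n.
have -> : series (term (t + h) x) n.+1 - series (term t x) n.+1 - h *: series (term t (B x)) n =
  \sum_(0 <= k < n) (exp_coeff (t + h) k.+1 - exp_coeff t k.+1 - h * exp_coeff t k)
     *: iter k B (B x).
  rewrite /series/= !big_nat_recl// /term/= /exp_coeff/= !expr0 fact0 divr1.
  rewrite opprD addrACA subrr add0r scaler_sumr -!sumrB; apply: eq_bigr => k _.
  by rewrite -iterSr !scalerBl scalerA.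
rewrite (le_trans (ler_norm_sum _ _ _))//.
apply: (@le_trans _ _ (h ^+ 2 * (b * series (exp_coeff ((t + h + 1) * b)) n) * `|x|)).
  rewrite /series/= mulr_sumr mulr_sumr mulr_suml; apply: ler_sum => k _.
  have /andP[H1 H2] := exp_coeff_taylor k t0 h0.
  rewrite normrZ ger0_norm//.
  have -> : h ^+ 2 * (b * exp_coeff ((t + h + 1) * b) k) * `|x| =
      h ^+ 2 * exp_coeff (t + h + 1) k * (b ^+ k * (b * `|x|)).
    by rewrite /exp_coeff/= exprMn; ring.
  rewrite ler_pM// (le_trans (iter_bound _ _))// ler_wpM2l ?exprn_ge0//.
rewrite ler_wpM2r// ler_wpM2l ?exprn_ge0// ler_wpM2l// series_exp_le//.
by rewrite mulr_ge0.
Qed.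

Lemma expB_B t x : 0 <= t -> B (expB t x) = expB t (B x).
Proof. by apply: expB_commute => //; exact: linear_bound_continuous HB. Qed.

(** Size, Lipschitz bound and Taylor remainder under a single constant, uniform on [[0, tau]], so
    that later error estimates carry only one [C]. *)
Lemma expB_estimates (tau : R) : 0 <= tau -> exists2 C : R, 0 < C &
  forall s t x, 0 <= s -> s <= t -> t <= tau ->
  [/\ `|expB t x| <= C * `|x|,
      `|expB t x - expB s x| <= C * (t - s) * `|x| &
      `|expB t x - expB s x - (t - s) *: B (expB s x)| <= C * (t - s) ^+ 2 * `|x| ].
Proof.
(* The Taylor bound involves [t + h + 1], hence [tau + 1] in the exponent. *)
move=> tau0; pose e1 := expR ((tau + 1) * b).
have e10 : 0 < e1 by exact: expR_gt0.
exists ((tau + 1) * b * e1 + e1); first by rewrite ltr_wpDl// !mulr_ge0 ?addr_ge0// ltW.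
move=> s t x s0 st tt; have t0 : 0 <= t by exact: le_trans st.
have x0 := normr_ge0 x.
have st0 : 0 <= t - s by rewrite subr_ge0.
have E r : r <= tau + 1 -> expR (r * b) <= e1.
  by move=> rt; rewrite ler_expR ler_wpM2r.
have H3 : `|expB t x - expB s x - (t - s) *: B (expB s x)| <= (t - s) ^+ 2 * (b * e1) * `|x|.
  have := expB_taylor x s0 st0; rewrite expB_B// (_ : s + (t - s) = t); last first.
    by rewrite addrC subrK.
  move=> /le_trans; apply.
  by rewrite ler_wpM2r// ler_wpM2l ?exprn_ge0// ler_wpM2l// E// lerD2r.
have be : 0 <= b * e1 by rewrite mulr_ge0// ltW.
have tbe : 0 <= tau * (b * e1) by rewrite mulr_ge0.
split.
- rewrite (le_trans (expB_bound _ t0))// ler_wpM2r//.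
  have : expR (t * b) <= e1 by apply: E; lra.
  lra.
- have -> : expB t x - expB s x = (expB t x - expB s x - (t - s) *: B (expB s x)) +
    (t - s) *: B (expB s x) by rewrite subrK.
  rewrite (le_trans (ler_normD _ _))// (le_trans (lerD H3 (lexx _)))// normrZ ger0_norm//.
  have H : `|B (expB s x)| <= b * e1 * `|x|.
    rewrite (le_trans (HB _))// -mulrA ler_wpM2l// (le_trans (expB_bound _ s0))//.
    by rewrite ler_wpM2r// E//; lra.
  apply: (@le_trans _ _ ((t - s) ^+ 2 * (b * e1) * `|x| + (t - s) * (b * e1 * `|x|))).
    by rewrite lerD2l ler_wpM2l.
  have -> : (t - s) ^+ 2 * (b * e1) * `|x| + (t - s) * (b * e1 * `|x|) =
    ((t - s) * (b * e1) + b * e1) * ((t - s) * `|x|) by ring.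
  rewrite -mulrA ler_wpM2r ?mulr_ge0//.
  have : (t - s) * (b * e1) <= tau * (b * e1) by rewrite ler_wpM2r//; lra.
  lra.
- rewrite (le_trans H3)// ler_wpM2r// mulrC ler_wpM2r ?exprn_ge0//; lra.
Qed.

Lemma expB_is_Rint t x : 0 <= t ->
  is_Rint (fun s => B (expB s x)) 0 t (expB t x - x).
Proof.
move=> t0; rewrite -[in X in _ - X](expB0 x).
have [C C0 HC] := expB_estimates t0.
have D0 : 0 < (b + 1) * C * (`|x| + 1) by rewrite !mulr_gt0// ltr_wpDl.
apply: (@is_Rint_primitive _ _ _ (fun s => expB s x)) => e e0.
exists (e / ((b + 1) * C * (`|x| + 1))); first by rewrite divr_gt0.
move=> s y r s0 sy yr rt; rewrite ltr_pdivlMr// => rs.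
have sr : s <= r by exact: le_trans yr.
have [_ _ H1] := HC s r x s0 sr rt.
have [_ H2 _] := HC s y x s0 sy (le_trans yr rt).
(* The tag [y] is first moved to the left end [s], where the Taylor estimate applies. *)
have -> : (r - s) *: B (expB y x) - (expB r x - expB s x) =
    (r - s) *: B (expB y x - expB s x) -
    (expB r x - expB s x - (r - s) *: B (expB s x)).
  by rewrite (linear_mapB lB) scalerBr; apply/esym; rewrite [X in _ + X]opprB subrKA.
rewrite (le_trans (ler_normB _ _))// normrZ ger0_norm ?subr_ge0//.
have H3 : `|B (expB y x - expB s x)| <= b * (C * (r - s) * `|x|).
  rewrite (le_trans (HB _))// ler_wpM2l// (le_trans H2)// ler_wpM2r// ler_wpM2l ?(ltW C0)//.
  by rewrite lerD2r.
have rs0 : 0 <= r - s by rewrite subr_ge0.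
rewrite (le_trans (lerD (ler_wpM2l rs0 H3) H1))//.
have -> : (r - s) * (b * (C * (r - s) * `|x|)) + C * (r - s) ^+ 2 * `|x| =
   ((r - s) * ((b + 1) * C * `|x|)) * (r - s) by ring.
rewrite ler_wpM2r// (le_trans _ (ltW rs))// ler_wpM2l// ler_wpM2l ?lerDl//.
by rewrite mulr_ge0 ?addr_ge0// ltW.
Qed.

End OperatorExponential.

(** * Closed loop *)

Section ClosedLoop.
Context (R : realType) (V : completeNormedModType R) (ip : V -> V -> R).
Context (A : set (V * V)) (S : R -> V -> V).
Hypotheses (hip : inner_product ip) (hA : generates A S).
Hypothesis A_sym : forall x x' y y', A (x, x') -> A (y, y') -> ip x' y = ip x y'.
Variables T q : R.
Hypotheses (T0 : 0 < T) (q0 : 0 < q).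

Let hS : C0_semigroup S. Proof. by case: hA. Qed.

(* [Fbar] on an arbitrary space. *)
Definition gramian (y : V) : V := Defs.Rint (fun s => q ^+ 2 *: S s (S s y)) 0 T.

Lemma gramian_is_Rint y : is_Rint (fun s => q ^+ 2 *: S s (S s y)) 0 T (gramian y).
Proof.
(* Since [S s (S s y) = S (s + s) y], the integrand is an orbit run at double speed, whose
   continuity is known. *)
have cf : continuous (fun t : R => q ^+ 2 *: S (Num.max 0 (t + t)) y).
  move=> t; apply: cvgZ; first exact: cvg_cst.
  apply: (continuous_comp (f := fun t : R => t + t) (g := fun t : R => S (Num.max 0 t) y)).
    by apply: cvgD; exact: cvg_id.
  exact: semigroup_continuous.
have [G [_ HG]] := primitive_exists (ltW T0) cf.
have H : is_Rint (fun s => q ^+ 2 *: S s (S s y)) 0 T (G T - G 0).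
  apply: eq_is_Rint (is_Rint_continuous cf HG) => s /andP[s0 _].
  by rewrite max_r ?addr_ge0// (C0_comp hS).
by rewrite /gramian (RintE (ltW T0) H).
Qed.

Lemma gramian_linear : linear gramian.
Proof.
move=> a x y; have T0' := ltW T0.
apply: (cvg_unique _ (lsum_cvg T0' (gramian_is_Rint _))) => //.
have -> : lsum (fun s => q ^+ 2 *: S s (S s (a *: x + y))) 0 T =
    (fun n => a *: lsum (fun s => q ^+ 2 *: S s (S s x)) 0 T n +
      lsum (fun s => q ^+ 2 *: S s (S s y)) 0 T n).
  apply/funext => n; rewrite /lsum scaler_sumr -big_split; apply: eq_bigr => i _ /=.
  have s0 : 0 <= grid 0 T n i by rewrite /grid add0r subr0 mulr_ge0// divr_ge0.
  rewrite !(C0_linear hS s0) !scalerDr !scalerA; congr (_ *: _ + _); ring.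
by apply: cvgD; [apply: cvgZ; first exact: cvg_cst|];
  apply: lsum_cvg => //; exact: gramian_is_Rint.
Qed.

Lemma gramian_bound : exists2 b : R, 0 <= b & forall x, `|gramian x| <= b * `|x|.
Proof.
have [M M1 HM] := semigroup_bound hS T; have M0 : 0 <= M by exact: le_trans M1.
have C0 : 0 <= q ^+ 2 * M ^+ 2 by rewrite mulr_ge0 ?exprn_ge0// ltW.
exists (q ^+ 2 * M ^+ 2 * T); first by rewrite mulr_ge0// ltW.
move=> x; pose g s := q ^+ 2 * M ^+ 2 * `|x| * s.
have -> : q ^+ 2 * M ^+ 2 * T * `|x| = g T - g 0 by rewrite /g; ring.
apply: (is_Rint_norm_le (ltW T0) (gramian_is_Rint x)) => s t s0 st tT.
rewrite /g -mulrBr normrZ ger0_norm ?subr_ge0// mulrC ler_wpM2r ?subr_ge0//.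
rewrite normrZ ger0_norm ?exprn_ge0 ?(ltW q0)// -mulrA ler_wpM2l ?exprn_ge0 ?(ltW q0)//.
have sT : s <= T by exact: le_trans tT.
by rewrite expr2 -mulrA (le_trans (HM _ _ s0 sT))// ler_wpM2l// HM.
Qed.

Lemma gramian_S t x : 0 <= t -> S t (gramian x) = gramian (S t x).
Proof.
move=> t0; apply: (is_Rint_unique (ltW T0) _ (gramian_is_Rint _)).
have := is_Rint_linear (C0_linear hS t0) (C0_bounded hS t0) (gramian_is_Rint x).
apply: eq_is_Rint => s /andP[s0 _].
have comm y : S t (S s y) = S s (S t y) by rewrite -!(C0_comp hS)// addrC.
by rewrite (linear_mapZ (C0_linear hS t0)) !comm.
Qed.

(** By symmetry [ip (S s (S s x)) x = |S s x|^2], so every left sum of [ip (gramian x) x] averages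
    values at least [c]. *)
Lemma gramian_ge x (c : R) : (forall s, 0 <= s <= T -> c <= `|S s x| ^+ 2) ->
  q ^+ 2 * T * c <= ip (gramian x) x.
Proof.
move=> Hc; have cv := lsum_cvg (ltW T0) (gramian_is_Rint x).
have {}cv : ip (lsum (fun s => q ^+ 2 *: S s (S s x)) 0 T n) x @[n --> \oo] -->
    ip (gramian x) x.
  exact: (cvg_comp _ _ cv (@ip_continuous _ _ _ hip x (gramian x))).
rewrite -(cvg_lim _ cv)//; apply: limr_ge; first by apply/cvg_ex; exists (ip (gramian x) x).
apply: nearW => n; rewrite /lsum.
have -> : q ^+ 2 * T * c = \sum_(i < n.+1) (grid 0 T n i.+1 - grid 0 T n i) * (q ^+ 2 * c).
  rewrite -mulr_suml -(telescope_vec n.+1 (grid 0 T n : nat -> R^o)) gridn grid0 subr0; ring.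
rewrite [leRHS](linear_sum (lin_of (ip_linear hip x)))/=; apply: ler_sum => i _.
have s0 : 0 <= grid 0 T n i by rewrite /grid add0r subr0 mulr_ge0 ?divr_ge0// ltW.
have sT : grid 0 T n i <= T.
  rewrite -[leRHS](gridn 0 T n); apply: (@partition_le _ n.+1).
    by move=> k _; exact: gridS_ge0 (ltW T0).
  by rewrite leqnn ltnW//= ltn_ord.
rewrite !(ipZl hip) ler_wpM2l ?subr_ge0 ?gridS_ge0 ?(ltW T0)// ler_pM2l ?exprn_gt0//.
by rewrite (semigroup_sym hip hA A_sym)// (ip_norm hip) Hc// s0.
Qed.

(** Chosen so that [1 - 2 s delta >= 1 / 2] up to [s = T]: a tangent of slope at least
    [- 2 delta |z|^2] then stays above [|z|^2 / 2] on [[0, T]]. It is also the decay rate. *)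
Let delta : R := (4 * T)^-1.

Let delta0 : 0 < delta. Proof. by rewrite invr_gt0 mulr_gt0. Qed.

(* If [<A z, z>] exceeds [- delta |z|^2] then [|S s z|^2 >= |z|^2 / 2] on [0, T],
   so that the feedback term dominates. *)
Lemma dissipative (M k : R) z z' : (forall x, `|S 1 x| <= M * `|x|) ->
  k <= - (2 * (M ^+ 2 + delta) / (q ^+ 2 * T)) -> A (z, z') ->
  ip z' z + k * ip (gramian z) z <= - delta * `|z| ^+ 2.
Proof.
move=> HM Hk Az; set n := `|z| ^+ 2; have n0 : 0 <= n by rewrite exprn_ge0.
have qT : 0 < q ^+ 2 * T by rewrite mulr_gt0// exprn_gt0.
have k0 : k <= 0.
  rewrite (le_trans Hk)// oppr_le0 divr_ge0 ?(ltW qT)// mulr_ge0// addr_ge0 ?(ltW delta0)//.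
  exact: sqr_ge0.
have [a1|a1] := ltP (ip z' z) (- delta * n).
  have : 0 <= ip (gramian z) z.
    by rewrite -(mulr0 (q ^+ 2 * T)); apply: gramian_ge => s _; exact: sqr_ge0.
  by move=> /(mulr_le0_ge0 k0); lra.
have F0 : q ^+ 2 * T * (n / 2) <= ip (gramian z) z.
  apply: gramian_ge => s /andP[]; rewrite le_eqVlt => /predU1P[<- _|s0 sT].
    by rewrite (C0_id hS) -/n; lra.
  have := semigroup_tangent hip hA A_sym Az s0; rewrite -/n; apply: le_trans.
  have h1 : 2 * s * (- delta * n) <= 2 * s * ip z' z by rewrite ler_wpM2l// mulr_ge0// ltW.
  have h2 : 2 * s * delta <= 1 / 2.
    rewrite /delta ler_pdivrMr ?mulr_gt0//; lra.
  have h3 : 2 * s * delta * n <= 1 / 2 * n by rewrite ler_wpM2r.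
  lra.
have aM : 2 * ip z' z <= M ^+ 2 * n.
  have := semigroup_tangent hip hA A_sym Az (@ltr01 R); rewrite mulr1 -/n.
  have : `|S 1 z| ^+ 2 <= (M * `|z|) ^+ 2.
    by rewrite lerXn2r ?nnegrE// (le_trans _ (HM z)).
  rewrite exprMn -/n; lra.
have h1 : k * ip (gramian z) z <= k * (q ^+ 2 * T * (n / 2)) by rewrite ler_wnM2l.
(* The factor [2] of the threshold makes up for the [1 / 2] in [F0]. *)
have h2 : k * (q ^+ 2 * T) <= - (2 * (M ^+ 2 + delta)).
  by rewrite -ler_pdivlMr// mulNr.
have h3 : k * (q ^+ 2 * T) * (n / 2) <= - (2 * (M ^+ 2 + delta)) * (n / 2).
  by rewrite ler_wpM2r// divr_ge0.
have h4 : 0 <= M ^+ 2 * n by rewrite mulr_ge0// sqr_ge0.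
lra.
Qed.

Variable k : R.

Let B (y : V) : V := k *: gramian y.

Let lB : linear B.
Proof. by move=> a x y; rewrite /B gramian_linear scalerDr !scalerA mulrC. Qed.

Let B_bound : exists2 b : R, 0 <= b & forall x, `|B x| <= b * `|x|.
Proof.
have [b b0 Hb] := gramian_bound; exists (`|k| * b); first by rewrite mulr_ge0.
by move=> x; rewrite normrZ -mulrA ler_wpM2l.
Qed.

Let B_S t x : 0 <= t -> S t (B x) = B (S t x).
Proof. by move=> t0; rewrite /B (linear_mapZ (C0_linear hS t0)) gramian_S. Qed.

Let E := expB B.

Definition closed_loop (x : V) (t : R) : V := expB B t (S t x).

Let E_S s t x : 0 <= s -> 0 <= t -> S t (E s x) = E s (S t x).
Proof.
move=> s0 t0; have [b b0 Hb] := B_bound.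
exact: (expB_commute b0 Hb x (C0_linear hS t0) (C0_bounded hS t0) (fun y => B_S y t0) s0).
Qed.

Let E_estimates (tau : R) : 0 <= tau -> exists2 C : R, 0 < C &
  forall s t x, 0 <= s -> s <= t -> t <= tau ->
  [/\ `|E t x| <= C * `|x|,
      `|E t x - E s x| <= C * (t - s) * `|x| &
      `|E t x - E s x - (t - s) *: B (E s x)| <= C * (t - s) ^+ 2 * `|x| ].
Proof. by have [b b0 Hb] := B_bound; exact: (expB_estimates lB b0 Hb). Qed.

Let E_linear t : 0 <= t -> linear (E t).
Proof. by have [b b0 Hb] := B_bound; exact: (expB_linear lB b0 Hb). Qed.

Let E_continuous t : 0 <= t -> continuous (E t).
Proof. by have [b b0 Hb] := B_bound; exact: (expB_continuous lB b0 Hb). Qed.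

Lemma closed_loop_ucontinuous x (t0 e : R) : 0 < e -> exists2 d : R, 0 < d &
  forall s t, 0 <= s <= t0 -> 0 <= t <= t0 -> `|s - t| < d ->
    `|closed_loop x s - closed_loop x t| <= e.
Proof.
move=> e0; have [t00|t00] := leP 0 t0; last first.
  by exists 1 => // s t; lra.
have [M M1 HM] := semigroup_bound hS t0; have M0 : 0 < M by exact: lt_le_trans M1.
have [C C0 HC] := E_estimates t00.
have e1 : 0 < e / 2 / C by rewrite !divr_gt0.
have [d d0 Hd] := semigroup_ucontinuous hS x t0 e1.
have D0 : 0 < C * M * (`|x| + 1) by rewrite !mulr_gt0// ltr_wpDl.
exists (Num.min d (e / 2 / (C * M * (`|x| + 1)))).
  by rewrite lt_min d0 !divr_gt0.
move=> s t; wlog st : s t / s <= t.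
  move=> H hs ht; have [/H|/ltW/H] := leP s t; first exact.
  by rewrite distrC (distrC (closed_loop x s)); exact.
move=> /andP[s0 s1] /andP[t1 t2]; rewrite lt_min => /andP[sd].
rewrite ltr_pdivlMr// => sD.
have -> : closed_loop x s - closed_loop x t =
    (E s (S t x) - E t (S t x)) + E s (S s x - S t x).
  by rewrite (linear_mapB (E_linear s0)) [RHS]addrC subrKA.
rewrite (le_trans (ler_normD _ _))// (splitr e) lerD//.
  have [_ + _] := HC s t (S t x) s0 st t2; rewrite distrC => /le_trans; apply.
  rewrite distrC ger0_norm ?subr_ge0// in sD.
  rewrite (le_trans _ (ltW sD))// -mulrA mulrCA ler_wpM2l ?subr_ge0// -mulrA ler_pM2l//.
  by rewrite (le_trans (HM _ _ t1 t2))// ler_pM2l// lerDl.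
have [+ _ _] := HC s s (S s x - S t x) s0 (lexx _) s1; move=> /le_trans; apply.
by rewrite mulrC -ler_pdivlMr// Hd// ?s0// t1.
Qed.

(** * Exponential decay under a dissipative feedback *)

Section Decay.
Hypothesis B_dissipative : forall z z', A (z, z') ->
  ip (z' + B z) z <= - delta * `|z| ^+ 2.

(** The one-sided form of [(|u|^2)' = 2 <(A + B) u, u> <= - 2 delta |u|^2]. The orbit stays in the
    domain because [E s] and [S s] preserve it, so [w = (A + B) u] and the orbit at [s + h] is
    [u + h *: w + r] with [r] small. *)
Let closed_loop_step z z' s (e : R) : A (z, z') -> 0 <= s -> 0 < e ->
  \forall h \near 0^'+, `|closed_loop z (s + h)| ^+ 2 <=
    (1 - 2 * delta * h) * `|closed_loop z s| ^+ 2 + e * h.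
Proof.
move=> Az s0 e0; pose u := closed_loop z s; pose w := E s (S s z') + B u.
have wu : ip w u <= - delta * `|u| ^+ 2.
  apply: (B_dissipative (z := u)); apply: (generator_commute hA (E_linear s0) (E_continuous s0)).
    by move=> t y t0; rewrite E_S.
  exact: (generator_S hA s0 Az).
have s10 : 0 <= s + 1 by rewrite addr_ge0.
have [M M1 HM] := semigroup_bound hS s; have M0 : 0 < M by exact: lt_le_trans M1.
have [C C0 HC] := E_estimates s10.
pose D := C * M * (1 + `|z| + `|z'|).
have zz' : 0 <= `|z| + `|z'| by rewrite addr_ge0.
have D0 : 0 < D by rewrite !mulr_gt0//; lra.
(* With this [e1] the cross term [2 * ip u r] costs at most [e / 2 * h]; the other half pays for
   [|h *: w + r|^2], which is quadratic in [h] and controlled through [W]. *)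
pose e1 := e / (4 * (`|u| + 1)).
have u1 : 0 < `|u| + 1 by rewrite ltr_wpDl.
have e10 : 0 < e1 by rewrite divr_gt0// mulr_gt0.
have e13 : 0 < e1 / (3 * D) by rewrite divr_gt0// mulr_gt0.
pose W := (`|w| + e1) ^+ 2 + 1.
have W0 : 0 < W by rewrite ltr_wpDl// sqr_ge0.
have n1 := (generator_quotient hA z z').1 Az _ e13.
have n2 : \forall h \near (0 : R)^'+, 0 < h by exact: nbhs_right_gt.
have n3 : \forall h \near (0 : R)^'+, h < Num.min 1 (Num.min (e1 / (3 * D)) (e / 2 / W)).
  by apply: nbhs_right_lt; rewrite !lt_min ltr01 e13 !divr_gt0.
apply: filterS3 n1 n2 n3 => h H1 h0; rewrite !lt_min => /and3P[h1 hD hW].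
have h0' := ltW h0.
pose r := closed_loop z (s + h) - u - h *: w.
have sh : s + h - s = h by rewrite addrC addKr.
have sh0 : 0 <= s + h by rewrite addr_ge0.
have ssh : s <= s + h by rewrite lerDl.
have sh1 : s + h <= s + 1 by rewrite lerD2l ltW.
(* Three errors, each at most [e1 * h / 3]: the difference quotient of [S] at [z], the Taylor
   remainder of [E], and the replacement of [E s] by [E (s + h)] on [S s z']. *)
have rE : r = E (s + h) (S s (S h z - z - h *: z')) +
    (E (s + h) (S s z) - E s (S s z) - h *: B (E s (S s z))) +
    h *: (E (s + h) (S s z') - E s (S s z')).
  rewrite !(linear_mapB (C0_linear hS s0)) (linear_mapZ (C0_linear hS s0)).
  rewrite !(linear_mapB (E_linear sh0)) (linear_mapZ (E_linear sh0)) -(C0_comp hS)//.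
  rewrite /r /w /u /closed_loop -/E scalerDr scalerBr.
  move: (E (s + h) (S (s + h) z)) (E (s + h) (S s z)) (E s (S s z)) (h *: B _)
    (h *: E (s + h) _) (h *: E s _) => a b c d f g.
  by rewrite [RHS]addrAC subrKA [a - b - g]addrAC -[b - c - d]addrA subrKA opprD addrACA.
have re : `|r| <= e1 * h.
  have [B1 _ _] := HC s (s + h) (S s (S h z - z - h *: z')) s0 ssh sh1.
  have [_ _ B2] := HC s (s + h) (S s z) s0 ssh sh1.
  have [_ B3 _] := HC s (s + h) (S s z') s0 ssh sh1.
  rewrite sh in B2 B3.
  have HMs y : `|S s y| <= M * `|y| by apply: HM.
  have b1 : C * `|S s (S h z - z - h *: z')| <= D * (e1 / (3 * D) * h).
    rewrite /D -mulrA -mulrA ler_pM2l// (le_trans (HMs _))// ler_pM2l//.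
    by rewrite (le_trans H1)// ler_peMl ?(mulr_ge0 (ltW e13) h0')//; lra.
  have b2 : C * h ^+ 2 * `|S s z| <= D * (e1 / (3 * D) * h).
    have -> : C * h ^+ 2 * `|S s z| = C * `|S s z| * h * h by ring.
    rewrite mulrA ler_wpM2r// ler_pM ?mulr_ge0 ?(ltW C0) ?(ltW hD)//.
    rewrite /D -mulrA ler_pM2l// (le_trans (HMs _))// ler_pM2l//.
    by have := normr_ge0 z'; lra.
  have b3 : h * (C * h * `|S s z'|) <= D * (e1 / (3 * D) * h).
    have -> : h * (C * h * `|S s z'|) = C * `|S s z'| * h * h by ring.
    rewrite mulrA ler_wpM2r// ler_pM ?mulr_ge0 ?(ltW C0) ?(ltW hD)//.
    rewrite /D -mulrA ler_pM2l// (le_trans (HMs _))// ler_pM2l//.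
    by have := normr_ge0 z; lra.
  have De : D * (e1 / (3 * D) * h) = e1 * h / 3 by field; rewrite gt_eqF.
  rewrite De in b1 b2 b3.
  rewrite rE (le_trans (ler_normD _ _))//.
  have -> : e1 * h = e1 * h / 3 + e1 * h / 3 + e1 * h / 3 by lra.
  rewrite lerD//; last by rewrite normrZ ger0_norm// (le_trans _ b3)// ler_pM2l.
  rewrite (le_trans (ler_normD _ _))// lerD//; first exact: le_trans B1 b1.
  exact: le_trans B2 b2.
have -> : closed_loop z (s + h) = u + (h *: w + r).
  by rewrite /r [h *: w + _]addrC subrK [RHS]addrC subrK.
rewrite (sqr_normD hip) -/u.
have ipr : ip u r <= `|u| * (e1 * h).
  by rewrite (le_trans (ip_le hip _ _))// ler_wpM2l.
have n4 : `|h *: w + r| ^+ 2 <= e / 2 * h.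
  have : `|h *: w + r| <= h * (`|w| + e1).
    rewrite (le_trans (ler_normD _ _))// normrZ gtr0_norm// mulrDr lerD2l.
    by rewrite [h * e1]mulrC.
  have p0 : 0 <= h * (`|w| + e1) by rewrite mulr_ge0// addr_ge0// ltW.
  move=> /(lerXn2r 2) -/(_ (normr_ge0 _) p0) /le_trans; apply.
  rewrite exprMn expr2 -mulrA mulrC ler_wpM2r//.
  rewrite ltr_pdivlMr// in hW; rewrite (le_trans _ (ltW hW))// ler_pM2l//.
  by rewrite /W lerDl.
have n5 : `|u| * (e1 * h) <= e / 4 * h.
  rewrite mulrA ler_wpM2r// /e1.
  have -> : `|u| * (e / (4 * (`|u| + 1))) = e / 4 * (`|u| / (`|u| + 1)).
    by field; rewrite gt_eqF.
  rewrite ler_piMr ?divr_ge0 ?(ltW e0)//.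
  by rewrite ler_pdivrMr// mul1r lerDl.
have n6 : h * ip w u <= h * (- delta * `|u| ^+ 2) by rewrite ler_pM2l.
rewrite (ipDr hip) (ipZr hip) (ipC hip u w); lra.
Qed.

(** The weighted square [expR (2 * delta * s) * |closed_loop z s|^2] is nonincreasing. *)
Let closed_loop_dom_decay z z' t : A (z, z') -> 0 <= t ->
  expR (delta * t) * `|closed_loop z t| <= `|z|.
Proof.
move=> Az t0; have [b b0 Hb] := B_bound.
pose v s := expR (2 * delta * s) * `|closed_loop z (Num.max 0 s)| ^+ 2.
have cv : continuous v.
  move=> s; apply: cvgM.
    apply: (continuous_comp (f := fun s : R => 2 * delta * s)).
      by apply: cvgM; [exact: cvg_cst|exact: cvg_id].
    exact: continuous_expR.
  apply: cvgM; apply: cvg_norm; apply: (@clamp_continuous _ _ (closed_loop z));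
    move=> t1 e1; exact: closed_loop_ucontinuous.
have : v t <= v 0.
  apply: right_dini_le => //.
    move=> c _ e e0; have /cvgrPdist_le/(_ e e0)[d /= d0 Hd] := cv c.
    by exists d => // x _ xc; rewrite distrC; apply: Hd; rewrite /= distrC.
  move=> s /andP[s0 st] e e0.
  (* [X] dominates the weight at [s + h] for all [h < 1], hence the step is applied with error
     [e / X]. *)
  pose X := expR (2 * delta * (s + 1)).
  have X0 : 0 < X by exact: expR_gt0.
  have n1 := closed_loop_step Az s0 (divr_gt0 e0 X0).
  have n2 : \forall h \near (0 : R)^'+, 0 < h by exact: nbhs_right_gt.
  have n3 : \forall h \near (0 : R)^'+, h < 1 by exact: nbhs_right_lt.
  apply: filterS3 n1 n2 n3 => h H h0 h1.
  rewrite /v !max_r// ?addr_ge0 ?(ltW h0)//.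
  set u := `|closed_loop z s| ^+ 2 in H *; have u0 : 0 <= u by rewrite exprn_ge0.
  have E1 : expR (2 * delta * h) * (1 - 2 * delta * h) <= 1.
    rewrite -[leRHS](expRxMexpNx_1 (2 * delta * h)) ler_pM2l ?expR_gt0//.
    exact: expR_ge1Dx.
  rewrite mulrDr expRD -mulrA -mulrBr.
  have E2 : expR (2 * delta * s) * expR (2 * delta * h) <= X.
    by rewrite -expRD ler_expR -mulrDr ler_pM2l ?mulr_gt0//; lra.
  have E3 : expR (2 * delta * h) * `|closed_loop z (s + h)| ^+ 2 <=
      expR (2 * delta * h) * ((1 - 2 * delta * h) * u + e / X * h).
    by rewrite ler_pM2l ?expR_gt0.
  have E4 : expR (2 * delta * h) * (1 - 2 * delta * h) * u <= 1 * u by rewrite ler_wpM2r.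
  apply: (@le_trans _ _ (expR (2 * delta * s) * (expR (2 * delta * h) * (e / X * h)))).
    by rewrite ler_pM2l ?expR_gt0//; lra.
  have eh0 : 0 <= e / X * h by rewrite mulr_ge0 ?divr_ge0 ?ltW.
  rewrite mulrA (le_trans (ler_wpM2r eh0 E2))// mulrA mulrCA divff ?mulr1//.
  by rewrite gt_eqF.
rewrite /v mulr0 expR0 mul1r maxxx max_r// {2}/closed_loop.
rewrite (expB0 b0 Hb) (C0_id hS) => H.
rewrite -(@ler_pXn2r _ 2) ?nnegrE ?mulr_ge0 ?expR_ge0//.
rewrite exprMn expr2 -expRD (_ : delta * t + delta * t = 2 * delta * t)//; lra.
Qed.

Lemma closed_loop_decay x t : 0 <= t -> `|closed_loop x t| <= expR (- (delta * t)) * `|x|.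
Proof.
move=> t0; rewrite expRN -ler_pdivrMl ?invr_gt0 ?expR_gt0// invrK.
have [M M1 HM] := semigroup_bound hS t; have M0 : 0 < M by exact: lt_le_trans M1.
have [C C0 HC] := E_estimates t0.
apply/ler_addgt0Pr => e e0.
(* The error [|x - z|] enters through [closed_loop (x - z) t], with factor
   [expR (delta * t) * (C * M)], and through [|z| <= |x| + |x - z|], with factor [1]. *)
pose X := expR (delta * t) * (C * M) + 1.
have X0 : 0 < X by rewrite ltr_wpDl// mulr_ge0 ?expR_ge0// mulr_ge0 ?ltW.
have [z [z' [Az xz]]] := generator_dense hA x (divr_gt0 e0 X0).
have -> : closed_loop x t = closed_loop (x - z) t + closed_loop z t.
  by rewrite /closed_loop -/E (linear_mapB (C0_linear hS t0)) (linear_mapB (E_linear t0)) subrK.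
rewrite (le_trans (ler_wpM2l (expR_ge0 _) (ler_normD _ _)))// mulrDr.
rewrite (le_trans (lerD (lexx _) (closed_loop_dom_decay Az t0)))//.
have h1 : `|closed_loop (x - z) t| <= C * M * `|x - z|.
  have [H _ _] := HC t t (S t (x - z)) t0 (lexx _) (lexx _).
  by rewrite (le_trans H)// -mulrA ler_pM2l// HM.
have h2 : expR (delta * t) * `|closed_loop (x - z) t| <=
    expR (delta * t) * (C * M * `|x - z|) by rewrite ler_wpM2l ?expR_ge0.
have h3 : `|z| <= `|x| + `|x - z|.
  by rewrite -lerBlDl (le_trans (lerB_dist _ _))// distrC.
have h4 : X * `|x - z| <= e by rewrite mulrC -ler_pdivlMr.
by rewrite /X in h4; lra.
Qed.

End Decay.

(** Commutation collapses the Duhamel integrand, [S (t - s) (B (E s (S s x))) = B (E s (S t x))]: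
    what remains is the integral equation of the exponential at the fixed vector [S t x]. *)
Lemma closed_loop_mild x :
  mild_solution S B x (fun t => closed_loop x (Num.max 0 t)).
Proof.
have [b b0 Hb] := B_bound; split.
  apply: continuous_subspaceT; apply: (@clamp_continuous _ _ (closed_loop x)).
  by move=> t1 e1; exact: closed_loop_ucontinuous.
move=> t t0; rewrite max_r//.
apply: eq_is_Rint (expB_is_Rint lB b0 Hb (S t x) t0) => s /andP[s0 st].
have ts0 : 0 <= t - s by rewrite subr_ge0.
by rewrite max_r// B_S// /closed_loop E_S// -(C0_comp hS)// subrK.
Qed.

(** Gronwall by iteration: in the weight [expR (2 * c * s)], with [c] above the bound [M * b] of the
    kernel, each use of the integral equation halves the distance. The iteration starts from the
    bounds of [y1] and [y2] on the compact [[0, t]]. *)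
Lemma mild_solution_unique x y1 y2 t : mild_solution S B x y1 ->
  mild_solution S B x y2 -> 0 <= t -> y1 t = y2 t.
Proof.
move=> [c1 m1] [c2 m2] t0.
have [b b0 Hb] := B_bound; have [M M1 HM] := semigroup_bound hS t.
have M0 : 0 < M by exact: lt_le_trans M1.
have sub : `[0, t] `<=` `[0 : R, +oo[ by move=> s /=; rewrite !in_itv/= andbT => /andP[].
have [W1 W10 HW1] := continuous_bounded_itv (continuous_subspaceW sub c1).
have [W2 W20 HW2] := continuous_bounded_itv (continuous_subspaceW sub c2).
pose c := M * b + 1; have c0 : 0 < c by rewrite ltr_wpDl// mulr_ge0// ltW.
pose W := W1 + W2; have W0 : 0 < W by rewrite addr_gt0.
have H n s : 0 <= s -> s <= t -> `|y1 s - y2 s| <= W / 2 ^+ n * expR (2 * c * s).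
  elim: n s => [|n IH] s s0 st.
    rewrite expr0 divr1 (le_trans (ler_normB _ _))//.
    rewrite (le_trans (lerD (HW1 s _) (HW2 s _))) ?in_itv/= ?s0// ler_peMr ?(ltW W0)//.
    by rewrite -expR0 ler_expR !mulr_ge0 ?(ltW c0).
  have Wn : 0 < W / 2 ^+ n.+1 by rewrite divr_gt0// exprn_gt0.
  pose g r := W / 2 ^+ n.+1 * expR (2 * c * r).
  apply: (@le_trans _ _ (g s - g 0)); last by rewrite gerBl mulr_ge0 ?expR_ge0// ltW.
  have rint := is_RintB (m1 s s0) (m2 s s0).
  have e : y1 s - S s x - (y2 s - S s x) = y1 s - y2 s by rewrite opprB subrKA.
  rewrite e in rint; apply: (is_Rint_norm_le s0 rint) => r r' r0 rr' r's.
  have rs : r <= s by exact: le_trans r's.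
  have sr0 : 0 <= s - r by rewrite subr_ge0.
  rewrite -(linear_mapB (C0_linear hS sr0)) -(linear_mapB lB) normrZ.
  rewrite ger0_norm ?subr_ge0//.
  have h1 : `|S (s - r) (B (y1 r - y2 r))| <= c * (W / 2 ^+ n * expR (2 * c * r)).
    apply: (@le_trans _ _ (M * (b * `|y1 r - y2 r|))).
      by rewrite (le_trans (HM _ _ sr0 _)) ?ler_pM2l//; lra.
    rewrite mulrA ler_pM ?mulr_ge0 ?(ltW M0)// ?lerDl//.
    by apply: IH => //; exact: le_trans st.
  have rr0 : 0 <= r' - r by rewrite subr_ge0.
  rewrite (le_trans (ler_wpM2l rr0 h1))// /g -mulrBr.
  have -> : (r' - r) * (c * (W / 2 ^+ n * expR (2 * c * r))) =
     W / 2 ^+ n.+1 * (expR (2 * c * r) * (2 * c * (r' - r))).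
    by rewrite exprS; field; rewrite expf_neq0.
  rewrite ler_pM2l//.
  (* Convexity of the exponential, with its tangent at the left endpoint [r]. *)
  have -> : 2 * c * r' = 2 * c * r + 2 * c * (r' - r) by lra.
  rewrite expRD -[X in _ <= _ - X]mulr1 -mulrBr ler_pM2l ?expR_gt0//.
  by have := expR_ge1Dx (2 * c * (r' - r)); lra.
apply/eqP; rewrite -subr_eq0 -normr_le0.
have cv : W / 2 ^+ n * expR (2 * c * t) @[n --> \oo] --> 0 * expR (2 * c * t).
  apply: cvgM; last exact: cvg_cst.
  have := @cvg_geometric R W (2^-1); rewrite gtr0_norm ?invr_gt0// invf_lt1//.
  move=> /(_ (ltr1n R 2)); apply: cvg_trans; apply: near_eq_cvg.
  by apply: nearW => n; rewrite /= exprVn.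
rewrite mul0r in cv; rewrite -(cvg_lim _ cv)//; apply: limr_ge.
  by apply/cvg_ex; exists 0.
by apply: nearW => n; exact: H.
Qed.

End ClosedLoop.

(** By uniqueness every mild solution is [closed_loop]. Its norm never exceeds the initial one, so
    [r = e] serves for stability. *)
Theorem symmetric_closed_loop_stable (R : realType) (V : completeNormedModType R)
    (ip : V -> V -> R) (A : set (V * V)) (S : R -> V -> V) (T q beta : R) :
  inner_product ip -> generates A S ->
  (forall x x' y y', A (x, x') -> A (y, y') -> ip x' y = ip x y') ->
  0 < T -> 0 < q -> 0 < beta ->
  exists2 alpha_bar : R, alpha_bar < 0 &
    forall alpha : R, alpha <= alpha_bar ->
      asymptotically_stable
        (mild_solution S (fun y => (alpha * beta) *: gramian S T q y)) 0.
Proof.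
move=> hip hA A_sym T0 q0 beta0; have hS : C0_semigroup S by case: hA.
have [M M1 HM] := semigroup_bound hS 1.
pose delta := (4 * T)^-1; have delta0 : 0 < delta by rewrite invr_gt0 mulr_gt0.
pose c := 2 * (M ^+ 2 + delta) / (q ^+ 2 * T).
have c0 : 0 < c.
  by rewrite divr_gt0// mulr_gt0// ?exprn_gt0// ltr_wpDl// sqr_ge0.
exists (- c / beta) => [|alpha Ha].
  by rewrite mulNr oppr_lt0 divr_gt0.
have Hk : alpha * beta <= - c by rewrite -ler_pdivlMr.
have HM1 x : `|S 1 x| <= M * `|x| by apply: HM.
have decay x t : 0 <= t -> `|closed_loop S T q (alpha * beta) x t| <=
    expR (- (delta * t)) * `|x|.
  apply: (closed_loop_decay hip hA T0 q0) => z z' Az.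
  by rewrite (ipDl hip) (ipZl hip); exact: (dissipative hip hA A_sym T0 q0 HM1).
have sol x y t : mild_solution S (fun y => (alpha * beta) *: gramian S T q y) x y ->
    0 <= t -> `|y t| <= expR (- (delta * t)) * `|x|.
  move=> my t0; have mc := closed_loop_mild hA T0 q0 (alpha * beta) x.
  rewrite (mild_solution_unique hA T0 q0 my mc t0) max_r//.
  exact: decay.
split.
- by move=> y0; eexists; exact: (closed_loop_mild hA T0 q0 (alpha * beta) y0).
- move=> e e0; exists e => // y0 y my; rewrite !subr0 => y0e t t0; rewrite subr0.
  rewrite (le_lt_trans (sol _ _ _ my t0))// (le_lt_trans _ y0e)// ler_piMl//.
  by rewrite expR_le1 oppr_le0 mulr_ge0// ltW.
- move=> y0 y my; apply/cvgrPdist_le => e e0.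
  (* For such [t], [1 + delta * t <= expR (delta * t)] already gives
     [|y0| <= e * expR (delta * t)]. *)
  have n1 : \forall t \near +oo, `|y0| / (e * delta) <= t.
    by apply: nbhs_pinfty_ge; exact: num_real.
  have n2 : \forall t \near +oo, (0 : R) <= t by apply: nbhs_pinfty_ge; exact: num_real.
  apply: filterS2 n1 n2 => t ht t0; rewrite sub0r normrN (le_trans (sol _ _ _ my t0))//.
  rewrite expRN ler_pdivrMl ?expR_gt0//.
  rewrite ler_pdivrMr ?mulr_gt0// in ht.
  have : e * (1 + delta * t) <= e * expR (delta * t) by rewrite ler_pM2l// expR_ge1Dx.
  by rewrite [expR _ * e]mulrC; apply: le_trans; lra.
Qed.

(** * The Hilbert space L2 *)

Section L2Hilbert.
Context d (T : measurableType d) (R : realType).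
Variable mu : {measure set T -> \bar R}.

Local Notation L2T := (L2 mu).
Local Notation LfT := (LfunType mu (lee1n 2)).
Local Open Scope quotient_scope.

Lemma measurable_Lfun (f : LfT) : measurable_fun setT f.
Proof. exact: measurable_funP. Qed.

Lemma L2_norm_sqr (f : LfT) :
  ((`|\pi_L2T f| ^+ 2)%:E = \int[mu]_x (f x ^+ 2)%:E)%E.
Proof.
rewrite L2_norm_pi -[LHS]/((fine _ ^+ 2)%:E) -powR_mulrn; last first.
  by rewrite fine_ge0// Lnorm_ge0.
rewrite -poweR_EFin finite_norm_fine powR_Lnorm//; apply: eq_integral => x _ /=.
by rewrite powR_mulrn// real_normK ?num_real.
Qed.

Lemma L2_piB (f g : LfT) : \pi_L2T (f - g) = \pi_L2T f - \pi_L2T g.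
Proof. by rewrite -scaleN1r L2_piD L2_piZ scaleN1r. Qed.

Lemma sqr_integrable_Lfun (g : T -> R) : measurable_fun setT g ->
  (\int[mu]_x (g x ^+ 2)%:E < +oo)%E -> exists f : LfT, f = g :> (T -> R).
Proof.
move=> mg g2; have Pg : g \in Lfun mu 2%:E.
  apply/andP; split; first by rewrite inE.
  rewrite !inE/= /finite_norm (@lty_poweRy _ _ 2)// powR_Lnorm//.
  congr (_ < _)%E: g2; apply: eq_integral => x _ /=.
  by rewrite powR_mulrn// real_normK ?num_real.
by exists (Lfun_Sub (lee1n 2) Pg); rewrite Lfun_valP.
Qed.

(** Riesz-Fischer: a weighted sum [W] of squared gaps is integrable, hence finite almost everywhere,
    where it forces geometric convergence of the representatives; Fatou turns the pointwise limit
    into a limit in norm. *)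
Lemma L2_fast_cauchy_cvg (v : nat -> L2T) :
  (forall k, `|v k.+1 - v k| <= 4^-1 ^+ k) -> exists l : L2T, v n @[n --> \oo] --> l.
Proof.
move=> Hv; pose f k : LfT := repr (v k).
have pf k : \pi_L2T (f k) = v k by rewrite reprK.
have mf k : measurable_fun setT (f k) by exact: measurable_Lfun.
have normB k m : ((`|v k - v m| ^+ 2)%:E = \int[mu]_x ((f k x - f m x) ^+ 2)%:E)%E.
  by rewrite -!pf -L2_piB L2_norm_sqr.
have tail m k : (m <= k)%N -> `|v k - v m| <= 2 * 4^-1 ^+ m.
  move=> mk; pose u i := v (m + i)%N; pose g i : R := - (2 * 4^-1 ^+ (m + i)).
  have -> : v k - v m = u (k - m)%N - u 0%N by rewrite /u subnKC// addn0.
  rewrite telescope_vec (@le_trans _ _ (g (k - m)%N - g 0%N))//.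
    apply: (@sum_telescope_le _ _ _ (fun i => u i.+1 - u i)) => i _.
    rewrite /u /g addnS (le_trans (Hv _))// exprS.
    have q0 : 0 <= (4^-1 : R) ^+ (m + i) by rewrite exprn_ge0// invr_ge0.
    lra.
  by rewrite /g addn0 opprK gerDr oppr_le0 mulr_ge0// exprn_ge0// invr_ge0.
(* The weight [4 ^+ k] leaves [w k] with integral at most [4^-1 ^+ k], while finiteness of [W x]
   yields gaps at most [Num.sqrt (fine (W x)) / 2 ^+ k]. *)
pose w k x : \bar R := (4 ^+ k * (f k.+1 x - f k x) ^+ 2)%:E.
have mw k : measurable_fun setT (w k).
  apply/measurable_EFinP; apply: measurable_funM; first exact: measurable_cst.
  by apply: measurable_funX; exact: measurable_funB.
have w0 k x : (0 <= w k x)%E.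
  by rewrite lee_fin mulr_ge0 ?sqr_ge0 ?exprn_ge0.
have intw k : (\int[mu]_x w k x <= (4^-1 ^+ k)%:E)%E.
  rewrite /w; under eq_integral do rewrite EFinM.
  have m2 : measurable_fun setT (fun x => ((f k.+1 x - f k x) ^+ 2)%:E).
    by apply/measurable_EFinP; apply: measurable_funX; exact: measurable_funB.
  rewrite ge0_integralZl_EFin ?exprn_ge0//; last by move=> x _; rewrite lee_fin sqr_ge0.
  rewrite -normB -EFinM lee_fin.
  have h : `|v k.+1 - v k| ^+ 2 <= (4^-1 ^+ k) ^+ 2.
    by rewrite lerXn2r ?nnegrE// exprn_ge0// invr_ge0.
  apply: (@le_trans _ _ (4 ^+ k * (4^-1 ^+ k) ^+ 2)); first by rewrite ler_pM2l// exprn_gt0.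
  by rewrite expr2 mulrA -exprMn divff// expr1n mul1r.
pose W x : \bar R := (\sum_(k <oo) w k x)%E.
have W0 x : (0 <= W x)%E by apply: nneseries_ge0 => k _ _; exact: w0.
have mW : measurable_fun setT W.
  by apply: (@ge0_emeasurable_sum _ _ _ _ w xpredT) => [k x _ _|k _].
have intW : (\int[mu]_x W x < +oo)%E.
  rewrite integral_nneseries//.
  apply: (@le_lt_trans _ _ (\sum_(k <oo) (4^-1 ^+ k)%:E)%E).
    by apply: lee_nneseries => [k _ _|k _]; [exact: integral_ge0|exact: intw].
  apply: (@le_lt_trans _ _ (1 * (1 - 4^-1)^-1)%:E); last exact: ltry.
  apply: lime_le; first by apply: is_cvg_nneseries => k _ _; rewrite lee_fin exprn_ge0.
  apply: nearW => n; rewrite sumEFin lee_fin.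
  have /(_ n) := @geometric_le_lim R _ 1 4^-1; rewrite ger0_norm//.
  move=> /(_ ler01); rewrite invr_gt0 invf_lt1// => /(_ (ltr0n R 4) (ltr1n R 4)).
  by rewrite /series/=; under eq_bigr do rewrite mul1r.
have aeW : {ae mu, forall x, W x \is a fin_num}.
  have iW : mu.-integrable setT W.
    apply/integrableP; split => //; under eq_integral do rewrite gee0_abs//.
    exact: intW.
  by have := integrable_ae measurableT iW; apply: filterS => x /(_ I).
have fcvg x : W x \is a fin_num -> exists l : R, f n x @[n --> \oo] --> l.
  move=> Wx; pose c := Num.sqrt (fine (W x)).
  have phi k : `|f k.+1 x - f k x| <= geometric c 2^-1 k.
    have wk : 4 ^+ k * (f k.+1 x - f k x) ^+ 2 <= fine (W x).
      rewrite -lee_fin fineK//; have := @nneseries_lim_ge R (w ^~ x) xpredT 0%N k.+1.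
      move=> /(_ (fun n _ _ => w0 n x)); apply: le_trans.
      by rewrite big_nat_recr//= leeDr// sume_ge0.
    rewrite /geometric/= exprVn ler_pdivlMr ?exprn_gt0//.
    have p0 : 0 <= `|f k.+1 x - f k x| * 2 ^+ k by rewrite mulr_ge0// exprn_ge0.
    rewrite -(ger0_norm p0) -sqrtr_sqr ler_wsqrtr// (le_trans _ wk)//.
    rewrite exprMn real_normK ?num_real// -exprM mulnC exprM mulrC.
    by rewrite (_ : 2 ^+ 2 = 4 :> R)// expr2 -natrM.
  pose phis := fun k => f k.+1 x - f k x.
  have cphi : cvgn (series phis).
    apply: normed_cvg; apply: (series_le_cvg _ _ phi) => // [n|]; first exact: le_trans (phi n).
    by apply: is_cvg_geometric_series; rewrite ger0_norm ?invr_ge0//; lra.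
  move: cphi => /cvg_ex[/= l Hl]; exists (f 0%N x + l).
  have -> : (fun n => f n x) = (fun n => f 0%N x + series phis n).
    apply/funext => n; rewrite /series/= /phis.
    by rewrite (telescope_sumr (fun k => f k x))// addrC subrK.
  by apply: cvgD => //; exact: cvg_cst.
(* The upper limit is measurable everywhere; its values on the null set where [W] is infinite do not
   matter. *)
pose g x : R := fine (limn_esup (fun k => (f k x)%:E)).
have mg : measurable_fun setT g.
  apply: measurableT_comp => //; apply: measurable_fun_limn_esup => k.
  exact/measurable_EFinP.
have gcvg x : W x \is a fin_num -> f n x @[n --> \oo] --> g x.
  move=> /fcvg[l Hl]; rewrite /g.
  have Hl' : (f n x)%:E @[n --> \oo] --> l%:E.
    by apply: cvg_EFin; [exact: nearW|exact: Hl].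
  by have [_ ->] := cvg_limn_einf_sup Hl'.
have gf m : (\int[mu]_x ((g x - f m x) ^+ 2)%:E <= ((2 * 4^-1 ^+ m) ^+ 2)%:E)%E.
  pose h k x : \bar R := ((f k x - f m x) ^+ 2)%:E.
  have mh k : measurable_fun setT (h k).
    by apply/measurable_EFinP; apply: measurable_funX; exact: measurable_funB.
  have h0 k x : (0 <= h k x)%E by rewrite lee_fin sqr_ge0.
  (* Almost everywhere the square is a limit, hence a lower limit, the form required by Fatou. *)
  have -> : (\int[mu]_x ((g x - f m x) ^+ 2)%:E = \int[mu]_x limn_einf (h^~ x))%E.
    apply: ae_eq_integral => //.
    - by apply/measurable_EFinP; apply: measurable_funX; exact: measurable_funB.
    - apply: measurableT_comp => //; apply: measurable_fun_limn_esup => k.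
      exact: measurableT_comp.
    apply: filterS aeW => x Wx _ /=; apply/esym.
    have hc : h n x @[n --> \oo] --> ((g x - f m x) ^+ 2)%:E.
      apply: cvg_EFin; first exact: nearW.
      have gc : f n x - f m x @[n --> \oo] --> g x - f m x.
        by apply: cvgB; [exact: gcvg|exact: cvg_cst].
      by rewrite /= expr2; apply: cvgM.
    by have [-> _] := cvg_limn_einf_sup hc.
  rewrite (le_trans (fatou _ _ mh _))//.
  rewrite limn_einf_lim; apply: lime_le; first exact: is_cvg_einfs.
  near=> n; apply: (@le_trans _ _ (\int[mu]_x h n x)%E).
    by apply: ereal_inf_lbound; exists n => //=.
  rewrite -normB lee_fin lerXn2r ?nnegrE// ?mulr_ge0 ?exprn_ge0 ?invr_ge0//.
  by apply: tail; near: n; exact: nbhs_infty_ge.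
have gfoo m : (\int[mu]_x ((g x - f m x) ^+ 2)%:E < +oo)%E.
  by rewrite (le_lt_trans (gf m))// ltry.
(* Square integrability is known for [g - f 0], so the limit is represented by [G + f 0]. *)
have [G HG] := sqr_integrable_Lfun (measurable_funB mg (mf 0%N)) (gfoo 0%N).
exists (\pi_L2T (G + f 0%N)).
have dist m : `|\pi_L2T (G + f 0%N) - v m| <= 2 * 4^-1 ^+ m.
  have c0 : 0 <= 2 * (4^-1 : R) ^+ m by rewrite mulr_ge0// exprn_ge0// invr_ge0.
  rewrite -(@ler_pXn2r _ 2) ?nnegrE// -lee_fin -pf -L2_piB L2_norm_sqr.
  rewrite (le_trans _ (gf m))//.
  rewrite (_ : (fun _ => _) = (fun x => ((g x - f m x) ^+ 2)%:E))//.
  by apply/funext => x; rewrite -[(_ - f m) x]/(G x + f 0%N x - f m x) HG/= subrK.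
apply/cvgrPdist_le => e e0.
have c : geometric 2 (4^-1 : R) n @[n --> \oo] --> 0.
  by apply: cvg_geometric; rewrite ger0_norm ?invr_ge0//; lra.
move/cvgrPdist_le : c => /(_ e e0); apply: filterS => n.
rewrite sub0r normrN /= => h; rewrite (le_trans (dist n))//.
exact: le_trans (ler_norm _) h.
Unshelve. all: by end_near. Qed.

End L2Hilbert.

(** The balls of radius [4^-1 ^+ k / 2] around [v k] belong to the filter, so consecutive ones meet
    and their centres are at most [4^-1 ^+ k] apart; the limit of [v] is the limit of the filter. *)
Lemma fast_cauchy_complete (R : realType) (V : normedModType R) :
  (forall v : nat -> V, (forall k, `|v k.+1 - v k| <= 4^-1 ^+ k) ->
     exists l : V, v n @[n --> \oo] --> l) ->
  forall F : set_system V, ProperFilter F -> cauchy F -> cvg F.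
Proof.
move=> HV F FF /cauchyP FC.
have q0 k : 0 < (4^-1 : R) ^+ k / 2 by rewrite divr_gt0// exprn_gt0// invr_gt0.
have /choice[v Hv] : forall k : nat, exists x : V, F (ball x (4^-1 ^+ k / 2)).
  by move=> k; exact: FC.
have /HV[l Hl] : forall k, `|v k.+1 - v k| <= 4^-1 ^+ k.
  move=> k; have [y [] ] := filter_ex (filterI (Hv k.+1) (Hv k)).
  rewrite -!ball_normE/= => h1 h2; rewrite (le_trans (ler_distD y _ _))//.
  rewrite distrC in h2; rewrite (le_trans (lerD (ltW h1) (ltW h2)))// exprS.
  by have := q0 k; lra.
apply/cvg_ex; exists l; apply/cvg_ballP => e e0.
have e2 : 0 < e / 2 by rewrite divr_gt0.
have c : (4^-1 : R) ^+ n @[n --> \oo] --> 0.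
  by apply: cvg_expr; rewrite ger0_norm ?invr_ge0//; lra.
move/cvgrPdist_lt : Hl => /(_ _ e2) n2; move/cvgrPdist_lt : c => /(_ e e0) n1.
 have [k [k1 k2]] := filter_ex (filterI n1 n2).
apply: filterS (Hv k) => y; rewrite -!ball_normE/= => vy.
rewrite (le_lt_trans (ler_distD (v k) _ _))// (splitr e) ltrD//.
rewrite (lt_trans vy)// ltr_pM2r ?invr_gt0// (le_lt_trans _ k1)//.
by rewrite sub0r normrN ler_norm.
Qed.

HB.instance Definition _ d (T : measurableType d) (R : realType)
    (mu : {measure set T -> \bar R}) :=
  Uniform_isComplete.Build (L2 mu)
    (fast_cauchy_complete (@L2_fast_cauchy_cvg d T R mu)).

(** * The inner product of L2 *)

Section L2InnerProduct.
Context d (T : measurableType d) (R : realType).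
Variable mu : {measure set T -> \bar R}.

Local Notation L2T := (L2 mu).
Local Notation LfT := (LfunType mu (lee1n 2)).
Local Open Scope quotient_scope.

Definition L2_ip (f g : L2T) : R := \int[mu]_x (f x * g x).

Lemma L2_ip_pi (f g : LfT) : L2_ip (\pi f) (\pi g) = \int[mu]_x (f x * g x).
Proof.
congr fine; apply: ae_eq_integral => //.
- by apply/measurable_EFinP; apply: measurable_funM; exact: measurable_Lfun.
- by apply/measurable_EFinP; apply: measurable_funM; exact: measurable_Lfun.
- have := L2_repr_pi f; have := L2_repr_pi g.
  by apply: filterS2 => x /= eg ef Dx; rewrite /L2_fun eg// ef.
Qed.

Lemma integrable_mul_Lfun (f g : LfT) : mu.-integrable setT (EFin \o (fun x => f x * g x)).
Proof.
by apply/Lfun1_integrable; apply: Lfun2_mul_Lfun1; exact: LfunP.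
Qed.

Lemma L2_inner_product : inner_product L2_ip.
Proof.
split.
- by move=> f g; congr fine; apply: eq_integral => x _; rewrite mulrC.
- move=> h a f g; rewrite -[f]reprK -[g]reprK -[h]reprK -L2_piZ -L2_piD !L2_ip_pi.
  move: (repr f) (repr g) (repr h) => {}f {}g {}h.
  rewrite -[RHS]/(a * _ + _) -RintegralZl//; last exact: integrable_mul_Lfun.
  rewrite -RintegralD//; last exact: integrable_mul_Lfun.
    by congr fine; apply: eq_integral => x _; congr EFin;
      rewrite -[(a *: f + g) x]/(a * f x + g x); ring.
  rewrite (_ : _ \o _ = EFin \o (fun x => (a *: f : LfT) x * h x)).
    exact: integrable_mul_Lfun.
  by apply/funext => x; congr EFin; rewrite -[(a *: f : LfT) x]/(a * f x) mulrA.
- move=> f; rewrite -[f]reprK L2_ip_pi; move: (repr f) => {}f.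
  apply: EFin_inj; rewrite L2_norm_sqr /Rintegral fineK; last first.
    by apply: integrable_fin_num => //; exact: integrable_mul_Lfun.
  by apply: eq_integral => x _; rewrite expr2.
Qed.

End L2InnerProduct.

(** * Symmetry of the Dirichlet Laplacian *)

Section DirichletLaplacian.
Context (R : realType) (L : R).
Hypothesis L0 : 0 < L.

Local Notation LfL := (LfunType (leb L) (lee1n 2)).
Local Open Scope quotient_scope.

Let leb_fin : leb L setT = L%:E.
Proof.
rewrite /leb/= /mrestr setTI lebesgue_measure_itv/= lte_fin L0.
by rewrite sube0.
Qed.

(** [leb L] is a measure on the whole line, so conditions on []0, L[] hold almost everywhere rather
    than everywhere. *)
Let leb_ae : {ae leb L, forall x, 0 < x < L}.
Proof.
exists (~` `]0, L[); split.
- exact: measurableC.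
- by rewrite /leb/= /mrestr setICl measure0.
- by move=> x /= h; rewrite in_itv/=.
Qed.

Lemma bounded_L2 (g : R -> R) (c : R) : measurable_fun setT g -> 0 <= c ->
  (forall x, 0 < x < L -> `|g x| <= c) ->
  exists2 f : LfL, f = g :> (R -> R) & `|\pi_(L2I L) f| <= c * Num.sqrt L.
Proof.
move=> mg c0 gc.
have mg2 : measurable_fun setT (fun x => (g x ^+ 2)%:E).
  by apply/measurable_EFinP; exact: measurable_funX.
have int : (\int[leb L]_x (g x ^+ 2)%:E <= (c ^+ 2 * L)%:E)%E.
  apply: (@le_trans _ _ (\int[leb L]_x (cst (c ^+ 2)%:E x))%E).
    apply: ae_ge0_le_integral => //.
    - by move=> x _; rewrite lee_fin sqr_ge0.
    - by move=> x _; rewrite lee_fin sqr_ge0.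
    - have [N [mN N0 sN]] := leb_ae; exists N; split => // x /= h.
      apply: sN => /= hx; apply: h => _; rewrite lee_fin -[leLHS]real_normK ?num_real//.
      by rewrite lerXn2r ?nnegrE// gc.
  by rewrite integral_cst// leb_fin -EFinM.
have [|f fg] := @sqr_integrable_Lfun _ _ _ (leb L) _ mg; first exact: le_lt_trans int (ltry _).
exists f => //; have s0 : 0 <= c * Num.sqrt L by rewrite mulr_ge0 ?sqrtr_ge0.
rewrite -(@ler_pXn2r _ 2) ?nnegrE// -lee_fin L2_norm_sqr fg exprMn sqr_sqrtr//.
exact: ltW.
Qed.

Lemma continuous_L2 (g : R -> R) : continuous g ->
  exists f : LfL, f = g :> (R -> R).
Proof.
move=> cg; have [M M0 HM] := continuous_bounded_itv (@continuous_subspaceT _ _ `[0, L] _ cg).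
have [||x xL|f fg _] := @bounded_L2 g M.
- exact: continuous_measurable_fun.
- exact: ltW.
- by apply: HM; rewrite in_itv/=; lra.
- by exists f.
Qed.

Lemma test_function_continuous phi : test_function L phi -> continuous phi.
Proof.
by move=> [d _ _] x; apply/differentiable_continuous/derivable1_diffP; exact: d.
Qed.

(* The difference quotients of a test function are test functions converging
   uniformly to its derivative, so a function orthogonal to all test functions
   is orthogonal to their derivatives as well. *)
Definition diff_quotient (h : R) (psi : R -> R) (x : R) : R := h^-1 *: (psi (x + h) - psi x).

Let derivable_shift (psi : R -> R) (h x : R) : derivable psi (x + h) 1 ->
  derivable (fun y => psi (y + h)) x 1.
Proof.
rewrite /derivable; set u := (X in cvg (X @ _) -> _); set w := (X in _ -> cvg (X @ _)).
by have -> : u = w by apply/funext => k; rewrite /u /w /= addrA.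
Qed.

Let derive1_shift (psi : R -> R) (h x : R) :
  derive1 (fun y => psi (y + h)) x = derive1 psi (x + h).
Proof.
rewrite /derive1; set u := (X in lim (X @ _) = _); set w := (X in _ = lim (X @ _)).
by have -> : u = w by apply/funext => k; rewrite /u /w /= addrA.
Qed.

Lemma diff_quotient_test psi : test_function L psi ->
  \forall h \near (0 : R)^'+, test_function L (diff_quotient h psi).
Proof.
move=> [dpsi cpsi [a [b [a0 bL supp]]]].
have n1 : \forall h \near (0 : R)^'+, 0 < h by exact: nbhs_right_gt.
have n2 : \forall h \near (0 : R)^'+, h < a by exact: nbhs_right_lt.
apply: filterS2 n1 n2 => h h0 ha.
have dB x : derivable (fun y => psi (y + h) - psi y) x 1.
  by apply: derivableB => //; exact: derivable_shift.
split.
- by move=> x; apply: derivableZ; exact: dB.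
- have -> : derive1 (diff_quotient h psi) = (fun x => h^-1 * (derive1 psi (x + h) - derive1 psi x)).
    apply/funext => x; rewrite derive1E deriveZ; last exact: dB.
    rewrite deriveB//; last exact: derivable_shift.
    by rewrite -!derive1E derive1_shift.
  move=> x; apply: cvgM; first exact: cvg_cst.
  apply: cvgB; last exact: cpsi.
  apply: (continuous_comp (f := fun y => y + h)); last exact: cpsi.
  by apply: cvgD; [exact: cvg_id|exact: cvg_cst].
(* The shift moves the support to the left only, hence the requirement [h < a]. *)
- exists (a - h), b; split => // [|x]; first by rewrite subr_gt0.
  rewrite in_itv/= => xab; rewrite /diff_quotient !supp ?subrr ?scaler0// in_itv/=.
    by apply: contra xab => /andP[h1 h2]; apply/andP; split; lra.
  by apply: contra xab => /andP[h1 h2]; apply/andP; split; lra.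
Qed.

Lemma diff_quotient_cvg psi (e : R) : test_function L psi -> 0 < e ->
  \forall h \near (0 : R)^'+, forall x, 0 < x < L -> `|diff_quotient h psi x - derive1 psi x| <= e.
Proof.
move=> [dpsi cpsi _] e0.
have [r r0 Hr] := uniformly_continuous_itv 0 L cpsi e0.
have n1 : \forall h \near (0 : R)^'+, 0 < h by exact: nbhs_right_gt.
have n2 : \forall h \near (0 : R)^'+, h < r by exact: nbhs_right_lt.
apply: filterS2 n1 n2 => h h0 hr x /andP[x0 xL].
have xh : x < x + h by rewrite ltrDl.
have D (y : R) : is_derive y (1 : R) psi (derive1 psi y).
  by rewrite derive1E; apply: derivableP; exact: dpsi.
(* The intermediate point [c] may exceed [L]; uniform continuity needs only [x] in [[0, L]]. *)
have [c] := MVT xh (fun y _ => D y)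
  (derivable_within_continuous (fun y _ => dpsi y)).
rewrite in_itv/= => /andP[xc cxh] E.
have hx : x + h - x = h by rewrite addrC addKr.
have -> : diff_quotient h psi x = derive1 psi c.
  rewrite /diff_quotient E hx -[LHS]/(h^-1 * (derive1 psi c * h)) mulrC mulfK// gt_eqF//.
by rewrite distrC; apply: Hr; rewrite ?in_itv/= ?ltr_distl; lra.
Qed.

Let L2_fine_norm (f : L2I L) (g : LfL) (phi : R -> R) (e : R) : g = phi :> (R -> R) ->
  ('N[leb L]_2%:E[EFin \o (fun x => (f x - phi x)%R)] < e%:E)%E ->
  `|f - \pi_(L2I L) g| < e.
Proof.
move=> <- H; rewrite -[f]reprK -L2_piB L2_norm_pi -lte_fin finite_norm_fine.
exact: H.
Qed.

Let weak_derivative_ip (f f1 : L2I L) phi (F F' : LfL) : weak_derivative f f1 ->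
  test_function L phi -> F = phi :> (R -> R) -> F' = derive1 phi :> (R -> R) ->
  L2_ip f (\pi F') = - L2_ip f1 (\pi F).
Proof.
move=> wf tphi EF EF'; have := wf phi tphi.
by rewrite -EF' -EF -{2}[f]reprK -{2}[f1]reprK !L2_ip_pi.
Qed.

Let ip_small (x : R) (c : R) : 0 <= c -> (forall e, 0 < e -> `|x| <= e * c) -> x = 0.
Proof.
move=> c0 H; apply/eqP; rewrite -normr_le0; apply/ler_addgt0Pr => e e0; rewrite add0r.
have c1 : 0 < c + 1 by rewrite ltr_wpDl.
rewrite (le_trans (H _ (divr_gt0 e0 c1)))// mulrAC ler_pdivrMr// ler_pM2l//; lra.
Qed.

Let hip := L2_inner_product (leb L).

Let orthogonal_derivative (w : L2I L) :
  (forall phi (F : LfL), test_function L phi -> F = phi :> (R -> R) -> L2_ip w (\pi F) = 0) ->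
  forall psi (F' : LfL), test_function L psi -> F' = derive1 psi :> (R -> R) ->
  L2_ip w (\pi F') = 0.
Proof.
move=> Hw psi F' tpsi EF'; apply: (@ip_small _ (`|w| * Num.sqrt L)).
  by rewrite mulr_ge0 ?sqrtr_ge0.
move=> e e0.
have n1 := diff_quotient_test tpsi; have n2 := diff_quotient_cvg tpsi e0.
have [h [th eh]] := @filter_ex _ ((0 : R)^'+) _ _ (filterI n1 n2).
have [Q EQ] := continuous_L2 (test_function_continuous th).
have mQ : measurable_fun setT (fun x => Q x - F' x).
  by apply: measurable_funB; exact: measurable_Lfun.
have [|D ED Dn] := @bounded_L2 _ e mQ (ltW e0).
  by move=> x xL; rewrite EQ EF'; exact: eh.
have -> : L2_ip w (\pi F') = - L2_ip w (\pi_(L2I L) (Q - F')).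
  by rewrite L2_piB (ipBr hip) (Hw _ _ th EQ) sub0r opprK.
rewrite normrN (le_trans (CauchySchwarz hip _ _))//.
rewrite mulrCA ler_wpM2l// (_ : \pi_(L2I L) (Q - F') = \pi_(L2I L) D)//.
by congr (\pi_(L2I L) _); apply/LfuneqP => x; rewrite ED.
Qed.

(** Integration by parts passes from test functions to their limits in the norm of H^1. The pair
    [(u, u1)] is arbitrary: it serves for a function with its weak derivative, and with [u1 = 0] for
    a function orthogonal to derivatives of test functions. *)
Let H1_0_limit (f f1 u u1 : L2I L) :
  (forall phi (F F' : LfL), test_function L phi ->
     F = phi :> (R -> R) -> F' = derive1 phi :> (R -> R) ->
     L2_ip u (\pi F') = - L2_ip u1 (\pi F)) ->
  (forall e : R, 0 < e -> exists2 phi, test_function L phi &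
      ('N[leb L]_2%:E[EFin \o (fun x => (f x - phi x)%R)] < e%:E)%E /\
      ('N[leb L]_2%:E[EFin \o (fun x => (f1 x - derive1 phi x)%R)] < e%:E)%E) ->
  L2_ip u f1 = - L2_ip u1 f.
Proof.
move=> Hu Hf; apply/eqP; rewrite -subr_eq0 opprK; apply/eqP.
apply: (@ip_small _ (`|u| + `|u1|)); first by rewrite addr_ge0.
move=> e e0; have [phi tphi [n1 n2]] := Hf e e0.
have [F EF] := continuous_L2 (test_function_continuous tphi).
have [F' EF'] : exists F' : LfL, F' = derive1 phi :> (R -> R).
  by apply: continuous_L2; case: tphi.
have h1 := L2_fine_norm EF n1; have h2 := L2_fine_norm EF' n2.
have -> : L2_ip u f1 + L2_ip u1 f = L2_ip u (f1 - \pi_(L2I L) F') + L2_ip u1 (f - \pi_(L2I L) F).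
  by rewrite !(ipBr hip) (Hu _ _ _ tphi EF EF'); lra.
rewrite (le_trans (ler_normD _ _))// mulrDr.
rewrite lerD// (le_trans (CauchySchwarz hip _ _))// mulrC ler_wpM2r// ltW//.
Qed.

Lemma laplacian_green (f f2 g g2 : L2I L) : laplacian L (f, f2) -> laplacian L (g, g2) ->
  L2_ip f2 g = L2_ip f g2.
Proof.
have green (f0 h0 g0 F1 G1 : L2I L) : weak_derivative f0 F1 ->
    is_second_derivative f0 h0 ->
    (forall e : R, 0 < e -> exists2 phi, test_function L phi &
      ('N[leb L]_2%:E[EFin \o (fun x => (g0 x - phi x)%R)] < e%:E)%E /\
      ('N[leb L]_2%:E[EFin \o (fun x => (G1 x - derive1 phi x)%R)] < e%:E)%E) ->
    L2_ip h0 g0 = - L2_ip F1 G1.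
  move=> wF [f1 wf1 wf2] Hg.
  have e1 : L2_ip f1 G1 = - L2_ip h0 g0.
    by apply: H1_0_limit Hg => phi F F'; exact: weak_derivative_ip.
  (* [f1 - F1] is orthogonal to test functions, hence to their derivatives, hence to the limit [G1]
     of such derivatives; this replaces [f1] by [F1] and makes the formula symmetric. *)
  have e2 : L2_ip (f1 - F1) G1 = - L2_ip 0 g0.
    apply: H1_0_limit Hg => phi F F' tphi EF EF'; rewrite (ip0l hip) oppr0.
    apply: (orthogonal_derivative _ tphi EF') => psi K tpsi EK.
    have [K' EK'] : exists K' : LfL, K' = derive1 psi :> (R -> R).
      by apply: continuous_L2; case: tpsi.
    have := weak_derivative_ip wf1 tpsi EK EK'.
    rewrite (weak_derivative_ip wF tpsi EK EK') (ipBl hip) => /oppr_inj ->.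
    by rewrite subrr.
  by move: e2; rewrite (ipBl hip) (ip0l hip) e1; lra.
move=> [[F1 wF HF] _ sf] [[G1 wG HG] _ sg].
rewrite (green _ _ _ _ _ wF sf HG) (ipC hip f g2) (green _ _ _ _ _ wG sg HF).
by rewrite (ipC hip).
Qed.

Lemma opA_symmetric (mu : R) (f f' g g' : L2I L) : opA L mu (f, f') ->
  opA L mu (g, g') -> L2_ip f' g = L2_ip f g'.
Proof.
move=> [[u u2] /= lu [<- <-]] [[v v2] /= lv [<- <-]].
rewrite (ipDl hip) (ipDr hip) (ipZl hip) (ipZr hip); congr (_ + _).
exact: laplacian_green.
Qed.

End DirichletLaplacian.

Theorem theorem3p4 (R : realType) (L mu : R) (etA : R -> L2I L -> L2I L)
    (D : nat -> R) :
  0 < L -> (pi / L) ^+ 2 < mu ->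
  generates (opA L mu) etA ->
  (forall d, eigenvalue_of (laplacian L) d <-> exists k, d = D k) ->
  (forall k, mu != - D k) ->
  forall T q beta : R, 0 < T -> 0 < q -> 0 < beta ->
  exists2 alpha_bar : R, alpha_bar < 0 &
    forall alpha : R, alpha <= alpha_bar ->
      asymptotically_stable
        (mild_solution etA (fun y => (alpha * beta) *: Fbar etA T q y)) 0.
Proof.
move=> L0 _ genA _ _ T q beta T0 q0 beta0.
(* [Fbar] and [gramian] are convertible. *)
apply: (symmetric_closed_loop_stable (L2_inner_product (leb L)) genA) => //.
by move=> f f' g g'; exact: opA_symmetric.
Qed.
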